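(* Let $C_n=\frac{1}{n+1}\binom{2n}{n}=\frac{(2n)!}{n!(n+1)!}$, $n=0,1,2,\ldots$, be the Catalan numbers. Then: (a) $\{C_n\}_{n=0}^{\infty}$ is an infinitely divisible Stieltjes moment sequence. (b) For each real $c>0$, the power sequence $\{C_n^c\}_{n=0}^{\infty}$ is Stieltjes determinate. (c) For each real $c>0$, the (unique) measure $\mu_c$ on $[0,\infty)$ with moment sequence $\{C_n^c\}_{n=0}^{\infty}$ (where $\mu_1$ is the measure with density $\frac{1}{2\pi}\sqrt{\frac{4-x}{x}}$ on $(0,4]$) has Mellin transform $$\mathcal{M}_c(s)\equiv\int_0^{\infty}t^s\,d\mu_c(t)=\left(\frac{2^{2s}}{\sqrt{\pi}}\cdot\frac{\Gamma(s+1/2)}{\Gamma(s+2)}\right)^c=\left(\frac{1}{s+1}\cdot\frac{\Gamma(2s+1)}{(\Gamma(s+1))^2}\right)^c,\quad s\ge 0.$$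
   Context: A real sequence $\{m_n\}_{n=0}^\infty$ is a Stieltjes moment sequence if there is a nonnegative measure $\mu$ on $[0,\infty)$ with $m_n=\int_{[0,\infty)}x^n\,d\mu(x)$ for all $n\ge0$; it is Stieltjes determinate (S-det) if such $\mu$ is unique, and Stieltjes indeterminate otherwise. A Stieltjes moment sequence $\{m_n\}$ is infinitely divisible (in the sense of Tyan) if $\{m_n^c\}_{n=0}^\infty$ is a Stieltjes moment sequence for every real $c>0$. *)

(* Defs.v *)
From HB Require Import structures.
From mathcomp Require Import all_boot all_order all_algebra.
From mathcomp Require Import all_classical all_reals all_analysis.
From mathcomp Require Import ring.

Set Implicit Arguments.
Unset Strict Implicit.
Unset Printing Implicit Defensive.

Import Order.TTheory GRing.Theory Num.Theory.
Import numFieldNormedType.Exports.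

Local Open Scope classical_set_scope.
Local Open Scope ring_scope.

(* A measure on [0, +oo[ is encoded as a Borel measure on the line that gives
   mass 0 to ]-oo, 0[. The integral is extended-real valued with a nonnegative
   integrand, so the equation also says that all the moments are finite. *)
Definition stieltjes_represents (R : realType)
    (mu : {measure set (measurableTypeR R) -> \bar R}) (m : nat -> R) : Prop :=
  mu `]-oo, 0[%classic = 0%E /\
  forall n : nat, (\int[mu]_(x in `[0%R, +oo[) (x ^+ n)%:E = (m n)%:E)%E.

Definition stieltjes_moment (R : realType) (m : nat -> R) : Prop :=
  exists mu : {measure set (measurableTypeR R) -> \bar R},
    stieltjes_represents mu m.

Definition stieltjes_determinate (R : realType) (m : nat -> R) : Prop :=
  stieltjes_moment m /\
  forall mu nu : {measure set (measurableTypeR R) -> \bar R},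
    stieltjes_represents mu m -> stieltjes_represents nu m ->
    forall A, measurable A -> mu A = nu A.

(* Terms of a Stieltjes moment sequence are nonnegative, so the values of powR
   at a negative base are irrelevant. *)
Definition stieltjes_infinitely_divisible (R : realType) (m : nat -> R) : Prop :=
  stieltjes_moment m /\
  forall c : R, 0 < c -> stieltjes_moment (fun n => m n `^ c).

Definition catalan (R : realType) (n : nat) : R := 'C(n.*2, n)%:R / n.+1%:R.

Lemma catalan_fact (R : realType) (n : nat) :
  catalan R n = n.*2`!%:R / (n`!%:R * n.+1`!%:R).
Proof.
have nz k : k`!%:R != 0 :> R by rewrite pnatr_eq0 -lt0n fact_gt0.
have e : ('C(n.*2, n) * (n`! * n`!) = n.*2`!)%N.
  by rewrite -(@bin_fact n.*2 n) -addnn ?leq_addr// addnK.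
rewrite /catalan -e factS !natrM; field.
by rewrite nz addrC natr1 pnatr_eq0.
Qed.

Definition catalan_density (R : realType) (x : R) : R :=
  (2 * pi)^-1 * Num.sqrt ((4 - x) / x).

(* Meaningful for x > 0; Rintegral returns 0 when the integral diverges. *)
Definition Gamma (R : realType) (x : R) : R :=
  Rintegral (@lebesgue_measure R) `]0, +oo[%classic
    (fun t => t `^ (x - 1) * expR (- t)).

(* The integral of t^s over [0, +oo[, where 0^0 = 1 and 0^s = 0 for s > 0. *)
Definition mellin (R : realType)
    (mu : {measure set (measurableTypeR R) -> \bar R}) (s : R) : \bar R :=
  (\int[mu]_(t in `[0%R, +oo[) (t `^ s)%:E)%E.

(* Main.v *)
Require Import Defs.
From HB Require Import structures.
From mathcomp Require Import all_boot all_order all_algebra.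
From mathcomp Require Import all_classical all_reals all_analysis.
From mathcomp Require Import measurable_realfun ring lra.
Import Order.TTheory GRing.Theory Num.Theory.
Import numFieldNormedType.Exports.
Local Open Scope classical_set_scope.
Local Open Scope ring_scope.

Set Implicit Arguments.
Unset Strict Implicit.

(* A measure on [0, +oo[ whose moments are at most K M^n lives on [0, M], and its
   distribution function is the limit of the integrals of the polynomials
   (1 - (x/M)^n)^k with k ~ n (M/t)^n, which decrease from 1 to 0 at x = t. So
   such measures, and hence their Mellin transforms at all real s >= 0, are
   determined by the moments; this gives determinacy, and it turns identities
   between Mellin transforms into recurrences at the integers.
   For the existence of mu_c put psi(s) = (s + 1)^(-3/2) exp(rho(s) - rho(0)) with
     rho(s) = d(s) + d(s + 1) + d(s + 2) + ...,
     d(s) = 3/2 ln(s + 1) - ln(s + 1/2) - 1/2 ln(s + 2)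
          = - ln(1 - 1/(2 s + 2)^2) - 1/2 ln(1 - 1/(2 s + 3)^2).
   The first form of d gives psi(s + 1) / psi(s) = (s + 1/2) / (s + 2), which is
   the recurrence of Gamma(s + 1/2) / Gamma(s + 2). The second form and the power
   series of the logarithm show that rho is a Laplace transform, because each
   1/(s + a) is one; expanding exp(c rho), so is psi^c for every c > 0. Hence
   (4^s psi(s))^c is the Mellin transform of a measure, and by determinacy
   4^s psi(s) is that of the density sqrt((4 - x) / x) / (2 pi), a Beta integral
   equal to the Gamma quotient. The second form of the quotient is Legendre's
   duplication formula, also obtained by comparing recurrences. *)

Section powers_in_the_unit_interval.
Context {R : realType}.
Implicit Types (q y p : R) (n : nat).

Lemma bernoulli_ineq n y : 0 <= y <= 1 -> 1 - n%:R * y <= (1 - y) ^+ n.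
Proof.
move=> /andP[y0 y1]; elim: n => [|n ih]; first by rewrite mul0r subr0 expr0.
rewrite exprS; apply: (@le_trans _ _ ((1 - y) * (1 - n%:R * y))); last first.
  by rewrite ler_wpM2l// subr_ge0.
have : 0 <= n%:R * y ^+ 2 by rewrite mulr_ge0// sqr_ge0.
rewrite -natr1; nra.
Qed.

Lemma onemX_le_expRN n y : 0 <= y <= 1 -> (1 - y) ^+ n <= expR (- (n%:R * y)).
Proof.
move=> /andP[y0 y1]; rewrite -mulrN mulrC expRM_natr.
by rewrite lerXn2r ?nnegrE ?subr_ge0 ?expR_ge0//; exact: expR_ge1Dx.
Qed.

Lemma natM_expr_le q n : 0 <= q < 1 -> n%:R * q ^+ n <= (1 - q)^-1.
Proof.
move=> /andP[q0 q1]; have q1' : 0 < 1 - q by rewrite subr_gt0.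
rewrite -[leRHS]mul1r ler_pdivlMr//; apply: (@le_trans _ _ (1 - q ^+ n)).
  elim: n => [|n ih]; first by rewrite !mul0r subrr.
  have : 0 <= (1 - q) * (1 - q ^+ n.+1).
    by rewrite mulr_ge0 ?subr_ge0 ?exprn_ile1// ltW.
  have : q * (n%:R * q ^+ n * (1 - q)) <= q * (1 - q ^+ n) by rewrite ler_wpM2l.
  rewrite exprS -natr1; lra.
by rewrite gerBl exprn_ge0.
Qed.

Lemma cvg_natM_expr q : 0 <= q < 1 -> (n%:R * q ^+ n) @[n --> \oo] --> (0 : R).
Proof.
move=> /andP[q0 q1]; pose r := (1 + q) / 2.
have [r0 r1 qr2] : [/\ 0 <= r, r < 1 & q <= r ^+ 2].
  by rewrite /r; have := sqr_ge0 (1 - q); split; lra.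
apply: (@squeeze_cvgr _ _ _ _ (cst 0) (fun n => (1 - r)^-1 * r ^+ n)).
- near=> n; rewrite mulr_ge0 ?exprn_ge0//=.
  apply: (@le_trans _ _ (n%:R * r ^+ n * r ^+ n)); last first.
    by rewrite ler_wpM2r ?exprn_ge0// natM_expr_le ?r0.
  by rewrite -mulrA -expr2 exprAC ler_wpM2l// lerXn2r ?nnegrE ?exprn_ge0.
- exact: cvg_cst.
- rewrite -[X in _ --> X](mulr0 (1 - r)^-1); apply: cvgMl_tmp.
  by apply: cvg_expr; rewrite ger0_norm.
Unshelve. all: by end_near.
Qed.

(* The factor [n] in the exponent sends the powers to [0] also at the jump
   [y = 1/p]; the exponent [p^n] alone would give [1/e] there. *)
Definition step_exponent p n : nat := (Num.truncn (n%:R * p ^+ n)).+1.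

Lemma cvg_step_lt p y : 1 <= p -> 0 <= y -> y * p < 1 ->
  ((1 - y ^+ n) ^+ step_exponent p n) @[n --> \oo] --> (1 : R).
Proof.
move=> p1 y0 yp1; have p0 : 0 <= p by rewrite (le_trans ler01).
have y1 : y < 1 by apply: le_lt_trans yp1; rewrite ler_peMr.
have yn01 n : 0 <= y ^+ n <= 1 by rewrite exprn_ge0//= exprn_ile1// ltW.
apply: (@squeeze_cvgr _ _ _ _
    (fun n => 1 - (n%:R * (y * p) ^+ n + y ^+ n)) (cst 1)).
- near=> n; have /andP[yn0 yn1] := yn01 n.
  rewrite exprn_ile1 ?subr_ge0 ?gerBl// andbT.
  apply: le_trans (bernoulli_ineq _ (yn01 n)).
  rewrite lerD2l lerN2 /step_exponent -natr1 mulrDl mul1r lerD2r.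
  rewrite exprMn (mulrC (y ^+ n)) mulrA ler_wpM2r//.
  by rewrite truncn_le// mulr_ge0// exprn_ge0.
- rewrite -[X in _ --> X]subr0 -[X in _ - X](addr0 0); apply: cvgB; first exact: cvg_cst.
  apply: cvgD; first by apply: cvg_natM_expr; rewrite yp1 mulr_ge0.
  by apply: cvg_expr; rewrite ger0_norm.
- exact: cvg_cst.
Unshelve. all: by end_near.
Qed.

Lemma cvg_step_ge p y : 1 <= p -> y <= 1 -> 1 <= y * p ->
  ((1 - y ^+ n) ^+ step_exponent p n) @[n --> \oo] --> (0 : R).
Proof.
move=> p1 y1 yp1; have p0 : 0 < p by rewrite (lt_le_trans ltr01).
have y0 : 0 <= y by rewrite -(pmulr_lge0 _ p0) (le_trans ler01).
have yn01 n : 0 <= y ^+ n <= 1 by rewrite exprn_ge0//= exprn_ile1.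
apply: (@squeeze_cvgr _ _ _ _ (cst 0) (fun n => expR (- n%:R))).
- near=> n; have /andP[yn0 yn1] := yn01 n; rewrite /= exprn_ge0 ?subr_ge0//=.
  apply: le_trans (onemX_le_expRN _ (yn01 n)) _; rewrite ler_expR lerN2.
  apply: (@le_trans _ _ (n%:R * (y * p) ^+ n)); first by rewrite ler_peMr// exprn_ege1.
  by rewrite exprMn (mulrC (y ^+ n)) mulrA ler_wpM2r// ltW// truncnS_gt.
- exact: cvg_cst.
- by move/cvg_pinftyP : (@cvgr_expR R) => /(_ _ cvgr_idn).
Unshelve. all: by end_near.
Qed.

End powers_in_the_unit_interval.

Section determinacy_from_geometric_growth.
Context {R : realType}.
Local Notation MR := (measurableTypeR R).
Implicit Types (mu nu : {measure set MR -> \bar R}) (m : nat -> R).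

Let measurable_EFin_exprn (D : set R) n :
  measurable_fun D (fun x : R => (x ^+ n)%:E).
Proof. by apply/measurable_EFinP; exact: measurable_funX. Qed.

Lemma stieltjes_represents_mass mu m : stieltjes_represents mu m ->
  mu `[0%R, +oo[%classic = (m 0%N)%:E.
Proof.
by case=> _ <-; under eq_integral do rewrite expr0; rewrite integral_cst// mul1e.
Qed.

Lemma stieltjes_represents_lty mu m (A : set MR) : stieltjes_represents mu m ->
  measurable A -> A `<=` `[0%R, +oo[%classic -> (mu A < +oo)%E.
Proof.
move=> mu_m mA A0; apply: (@le_lt_trans _ _ (mu `[0%R, +oo[%classic)).
  by apply: le_measure; rewrite ?inE.
by rewrite (stieltjes_represents_mass mu_m) ltry.
Qed.

Lemma stieltjes_represents_markov mu m (x : R) n : 0 < x ->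
    stieltjes_represents mu m ->
  (mu `[x, +oo[%classic <= (m n / x ^+ n)%:E)%E.
Proof.
move=> x0 [_ mu_moment]; rewrite EFinM lee_pdivlMr ?exprn_gt0// muleC -mu_moment.
rewrite -integral_cst//.
apply: (@le_trans _ _ (\int[mu]_(y in `[x, +oo[) (y ^+ n)%:E)%E).
  apply: ge0_le_integral => //.
  - by move=> y _; rewrite lee_fin exprn_ge0// ltW.
  - exact: measurable_EFin_exprn.
  - move=> y /=; rewrite in_itv/= andbT => xy.
    by rewrite lee_fin lerXn2r// nnegrE ?(ltW x0)// (le_trans (ltW x0)).
apply: ge0_subset_integral => //.
- exact: measurable_EFin_exprn.
- by move=> y /=; rewrite in_itv/= andbT => y0; rewrite lee_fin exprn_ge0.
- by apply: subset_itvr; rewrite bnd_simp ltW.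
Qed.

Lemma stieltjes_represents_support mu m (K M : R) : 0 < M ->
    (forall n, m n <= K * M ^+ n) -> stieltjes_represents mu m ->
  mu `]M, +oo[%classic = 0%E.
Proof.
move=> M0 mK mu_m; have tail x : M < x -> mu `[x, +oo[%classic = 0%E.
  move=> Mx; have x0 : 0 < x by rewrite (lt_trans M0).
  apply/eqP; rewrite eq_le measure_ge0 andbT.
  apply: (@cvge_ge _ \oo _ _ (fun n => (K * (M / x) ^+ n)%:E)).
    apply: nearW => n; apply: le_trans (stieltjes_represents_markov n x0 mu_m) _.
    by rewrite lee_fin expr_div_n mulrA ler_wpM2r// invr_ge0 exprn_ge0// ltW.
  apply: cvg_EFin; first exact: nearW.
  rewrite -[X in _ --> X](mulr0 K); apply: cvgMl_tmp; apply: cvg_expr.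
  by rewrite ger0_norm ?divr_ge0 ?ltW// ltr_pdivrMr// mul1r.
apply/negligibleP => //; rewrite itvoyEbigcup; apply: negligible_bigcup => k.
by apply/negligibleP => //; apply: tail; rewrite ltrDl.
Qed.

Lemma stieltjes_represents_horner mu m (M : R) (p : {poly R}) :
    stieltjes_represents mu m -> mu `]M, +oo[%classic = 0%E ->
  (\int[mu]_(x in `[0%R, M]) (p.[x])%:E = (\sum_(i < size p) p`_i * m i)%:E)%E.
Proof.
move=> [_ mu_moment] muM.
have moment n : (\int[mu]_(x in `[0%R, M]) (x ^+ n)%:E = (m n)%:E)%E.
  rewrite -mu_moment [RHS](ge0_negligible_integral _ _ _ _ muM)//.
  - congr (integral _ _ _); apply/seteqP; split => x /=; rewrite !in_itv/= !andbT.
      by move=> /andP[-> xM]; split=> //; apply/negP; rewrite -leNgt.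
    by move=> [-> /negP]; rewrite -leNgt.
  - exact: measurable_EFin_exprn.
  - by move=> x /=; rewrite in_itv/= andbT => x0; rewrite lee_fin exprn_ge0.
have integrable_exprn n : mu.-integrable `[0%R, M] (fun x => (x ^+ n)%:E).
  apply/integrableP; split; first exact: measurable_EFin_exprn.
  under eq_integral => x.
    rewrite inE/= in_itv/= => /andP[x0 _]; rewrite ger0_norm ?exprn_ge0//; over.
  by rewrite moment ltry.
under eq_integral do rewrite horner_coef -sumEFin.
rewrite integral_sum//; last by move=> i; exact: (integrableZl _ p`_i (integrable_exprn i)).
rewrite -sumEFin; apply: eq_bigr => i _.
by under eq_integral do rewrite EFinM; rewrite integralZl// moment.
Qed.

Definition step_poly (M t : R) n : {poly R} :=
  (1 - (M^-1 *: 'X) ^+ n) ^+ step_exponent (M / t) n.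

Lemma horner_step_poly M t n x :
  (step_poly M t n).[x] = (1 - (x / M) ^+ n) ^+ step_exponent (M / t) n.
Proof. by rewrite /step_poly !hornerE mulrC. Qed.

Lemma step_poly_itv01 M t n x : 0 <= x <= M -> 0 <= (step_poly M t n).[x] <= 1.
Proof.
move=> /andP[x0 xM]; rewrite horner_step_poly.
have M0 : 0 <= M by rewrite (le_trans x0).
have /andP[y0 y1] : 0 <= (x / M) ^+ n <= 1.
  have xM1 : x / M <= 1.
    have [->|Mn0] := eqVneq M 0; first by rewrite invr0 mulr0.
    by rewrite ler_pdivrMr ?mul1r// lt_def Mn0.
  by rewrite exprn_ge0 ?exprn_ile1 ?divr_ge0.
by rewrite exprn_ge0 ?exprn_ile1 ?subr_ge0 ?gerBl.
Qed.

Lemma cvg_step_poly M t x : 0 < t <= M -> 0 <= x <= M ->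
  (step_poly M t n).[x] @[n --> \oo] --> (\1_`[0, t[%classic x : R).
Proof.
move=> /andP[t0 tM] /andP[x0 xM]; have M0 : 0 < M by rewrite (lt_le_trans t0).
have Mt1 : 1 <= M / t by rewrite ler_pdivlMr// mul1r.
have xMtE : x / M * (M / t) = x / t by field; rewrite !gt_eqF.
under eq_cvg do rewrite horner_step_poly.
rewrite indicE; have [xt|tx] := ltP x t.
  rewrite mem_set/=; last by rewrite in_itv/= x0.
  apply: cvg_step_lt; rewrite ?xMtE ?ltr_pdivrMr ?mul1r//.
  by rewrite divr_ge0// ltW.
rewrite memNset/=; last by rewrite in_itv/= ltNge tx andbF.
by apply: cvg_step_ge; rewrite ?xMtE ?ler_pdivlMr ?ler_pdivrMr ?mul1r.
Qed.

Lemma stieltjes_represents_cvg_cdf mu m (M t : R) : 0 < t <= M ->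
    stieltjes_represents mu m -> mu `]M, +oo[%classic = 0%E ->
  ((\sum_(i < size (step_poly M t n)) (step_poly M t n)`_i * m i)%:E
     @[n --> \oo] --> mu `[0%R, t[%classic)%E.
Proof.
move=> /andP[t0 tM] mu_m muM.
under eq_cvg do rewrite -(stieltjes_represents_horner _ mu_m muM).
have -> : mu `[0%R, t[%classic = (\int[mu]_(x in `[0%R, M]) (\1_(`[0%R, t[) x)%:E)%E.
  by rewrite integral_indic// setIidl//; apply: subset_itvl; rewrite bnd_simp.
have mu_lty : (mu `[0%R, M]%classic < +oo)%E.
  by apply: (stieltjes_represents_lty mu_m) => //; exact: subset_itvl.
have [] // := @dominated_convergence _ _ _ mu `[0%R, M] _
  (fun n x => ((step_poly M t n).[x])%:E) (fun x => (\1_(`[0%R, t[) x)%:E) (cst 1%E).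
- by move=> n; apply/measurable_EFinP; exact: measurable_poly.
- by apply/measurable_EFinP; exact: measurable_indic.
- apply: aeW => x /=; rewrite in_itv/= => x0M.
  apply: cvg_EFin; first exact: nearW.
  by apply: cvg_step_poly; rewrite ?t0.
- apply/integrableP; split => //.
  by under eq_integral do rewrite abse1; rewrite integral_cst// mul1e.
- apply: aeW => x n /=; rewrite in_itv/= => /(step_poly_itv01 t n)/andP[p0 p1].
  by rewrite lee_fin ger0_norm.
Qed.

Lemma eq_measure_rays mu nu :
    (forall t, mu `]-oo, t[%classic = nu `]-oo, t[%classic) ->
    (forall t, (mu `]-oo, t[%classic < +oo)%E) ->
  forall A, measurable A -> mu A = nu A.
Proof.
move=> mu_nu mu_lty A mA; apply: (@measure_unique _ R MR (@RGenInftyO.G R)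
  (fun k => `]-oo, k%:R[%classic)) mA => //.
- exact: RGenInftyO.measurableE.
- move=> _ _ [x ->] [y ->]; exists (Num.min x y).
  by apply/seteqP; split => z /=; rewrite !in_itv/= lt_min => /andP.
- by move=> i; exists i%:R.
- apply/seteqP; split => x // _; exists (Num.truncn x).+1 => //=.
  by rewrite in_itv/= truncnS_gt.
- by move=> _ [x ->]; exact: mu_nu.
Qed.

Lemma stieltjes_represents_ray mu m (t : R) : stieltjes_represents mu m ->
  mu `]-oo, t[%classic = mu `[0%R, t[%classic.
Proof.
move=> [mu0 _]; rewrite -[RHS](measureU0 _ _ mu0)//.
have [t0|t0] := leP t 0.
  rewrite (_ : `[0, t[%classic = set0) ?set0U; last first.
    by apply/seteqP; split => x //=; rewrite in_itv/= => /andP[]; lra.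
  rewrite mu0; apply/eqP; rewrite eq_le measure_ge0 andbT -mu0.
  by apply: le_measure; rewrite ?inE//; apply: subset_itvl; rewrite bnd_simp.
by rewrite setUC -itv_bndbnd_setU ?bnd_simp// ltW.
Qed.

Theorem stieltjes_represents_inj mu nu m (K M : R) : 0 < M ->
    (forall n, m n <= K * M ^+ n) ->
    stieltjes_represents mu m -> stieltjes_represents nu m ->
  forall A, measurable A -> mu A = nu A.
Proof.
move=> M0 mK mu_m nu_m; have K0 : 0 <= K.
  apply: (@le_trans _ _ (m 0%N)); last by have := mK 0%N; rewrite expr0 mulr1.
  by rewrite -lee_fin -(stieltjes_represents_mass mu_m).
apply: eq_measure_rays => t; last first.
  rewrite (stieltjes_represents_ray _ mu_m).
  by apply: (stieltjes_represents_lty mu_m) => //; exact: subset_itvl.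
rewrite (stieltjes_represents_ray _ mu_m) (stieltjes_represents_ray _ nu_m).
have [t0|t0] := leP t 0.
  by rewrite set_itv_ge ?measure0// bnd_simp -leNgt.
pose N := Num.max M t; have N0 : 0 < N by rewrite lt_max M0.
have tN : 0 < t <= N by rewrite t0 le_max lexx orbT.
have mN n : m n <= K * N ^+ n.
  apply: le_trans (mK n) _; rewrite ler_wpM2l// lerXn2r ?nnegrE ?(ltW M0) ?(ltW N0)//.
  by rewrite le_max lexx.
have cdf la (la_m : stieltjes_represents la m) :=
  stieltjes_represents_cvg_cdf tN la_m (stieltjes_represents_support N0 mN la_m).
exact: cvg_unique (cdf _ mu_m) (cdf _ nu_m).
Qed.

End determinacy_from_geometric_growth.

Section measure_with_density.
Local Open Scope ereal_scope.
Context d (T : measurableType d) (R : realType).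
Variables (mu : {measure set T -> \bar R}) (D : set T) (f : T -> R).
Hypotheses (mD : measurable D) (mf : measurable_fun D f).
Hypothesis f0 : forall x, D x -> (0 <= f x)%R.

Import HBNNSimple.

Let density A := \int[mu]_(x in A `&` D) (f x)%:E.

Let density0 : density set0 = 0.
Proof. by rewrite /density set0I integral_set0. Qed.

Let density_ge0 A : 0 <= density A.
Proof. by apply: integral_ge0 => x [_ Dx]; rewrite lee_fin f0. Qed.

Let density_sigma_additive : semi_sigma_additive density.
Proof.
move=> /= F mF tF mUF; rewrite /density setI_bigcupl; apply: cvg_toP.
  apply: ereal_nondecreasing_is_cvgn => m n mn.
  by apply: lee_sum_nneg_natr => // k _ _; exact: density_ge0.
rewrite ge0_integral_bigcup//=.
- by move=> k; exact: measurableI.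
- apply/measurable_EFinP; apply: measurable_funS mf => //.
  by apply: bigcup_sub => k _; exact: subIsetr.
- by move=> x [k _ [_ Dx]]; rewrite lee_fin f0.
- exact: trivIset_setIr.
Qed.

Definition density_measure : {measure set T -> \bar R} := HB.pack density
  (isMeasure.Build _ _ _ density density0 density_ge0 density_sigma_additive).

Lemma density_measureE A :
  density_measure A = \int[mu]_(x in A `&` D) (f x)%:E.
Proof. by []. Qed.

Let measurable_density E : measurable E -> measurable_fun (E `&` D) (EFin \o f).
Proof.
by move=> mE; apply/measurable_EFinP; apply: measurable_funS mf => //; exact: subIsetr.
Qed.

Lemma integral_density_indic E A : measurable E -> measurable A ->
  \int[density_measure]_(x in E) (\1_A x)%:E =
  \int[mu]_(x in E `&` D) ((\1_A x)%:E * (f x)%:E).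
Proof.
move=> mE mA; rewrite integral_indic// density_measureE -setIA integral_mkcondl.
by apply: eq_integral => x _; rewrite patchE indicE; case: ifPn; rewrite ?mul1e ?mul0e.
Qed.

Lemma integral_density_nnsfun E (h : {nnsfun T >-> R}) : measurable E ->
  \int[density_measure]_(x in E) (h x)%:E =
  \int[mu]_(x in E `&` D) ((h x)%:E * (f x)%:E).
Proof.
move=> mE; have mED : measurable (E `&` D) by exact: measurableI.
have mh r : measurable (h @^-1` [set r]) by exact: measurable_funPTI.
transitivity (\sum_(r \in range h) (r%:E *
    \int[mu]_(x in E `&` D) ((\1_(h @^-1` [set r]) x)%:E * (f x)%:E))).
  under eq_integral do rewrite fimfunE -fsumEFin//.
  rewrite ge0_integral_fsum//; last 2 first.
  - by move=> r; apply/measurable_EFinP/measurable_funTS/measurable_funM.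
  - by move=> r x _; rewrite nnfun_muleindic_ge0.
  by apply: eq_fsbigr => r _; rewrite integralZl_indic_nnsfun// integral_density_indic.
under [RHS]eq_integral do rewrite fimfunE -fsumEFin//.
under [RHS]eq_integral => x xED.
  rewrite ge0_mule_fsuml; last by move=> r; exact: nnfun_muleindic_ge0.
  over.
rewrite ge0_integral_fsum//; last 2 first.
- move=> r; apply: emeasurable_funM; last exact: measurable_density.
  by apply/measurable_EFinP/measurable_funTS/measurable_funM.
- by move=> r x [_ xD]; rewrite mule_ge0 ?lee_fin ?f0// -?lee_fin ?nnfun_muleindic_ge0.
apply: eq_fsbigr => r /[!inE] -[z _ <-].
under [RHS]eq_integral do rewrite EFinM -muleA.
rewrite ge0_integralZl_EFin//.
- by move=> x [_ xD]; rewrite mule_ge0 ?lee_fin ?f0.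
- apply: emeasurable_funM; last exact: measurable_density.
  exact/measurable_EFinP/measurable_funTS.
Qed.

Lemma ge0_integral_density E (g : T -> \bar R) : measurable E ->
    measurable_fun E g -> (forall x, E x -> 0 <= g x) ->
  \int[density_measure]_(x in E) g x = \int[mu]_(x in E `&` D) (g x * (f x)%:E).
Proof.
move=> mE mg g0; pose h := nnsfun_approx mE mg.
transitivity (limn (fun n => \int[density_measure]_(x in E) (h n x)%:E)).
  rewrite -monotone_convergence//.
  - apply: eq_integral => x /[!inE] xE; apply/esym/cvg_lim => //.
    exact: cvg_nnsfun_approx.
  - by move=> n; exact/measurable_EFinP/measurable_funTS.
  - by move=> n x _; rewrite lee_fin.
  - by move=> x _ m n mn; rewrite lee_fin; exact/lefP/nd_nnsfun_approx.
under eq_fun do rewrite integral_density_nnsfun//.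
rewrite -monotone_convergence//.
- apply: eq_integral => x /[!inE] -[xE xD]; apply/cvg_lim => //.
  by apply: cvgeZr => //; exact: cvg_nnsfun_approx.
- exact: measurableI.
- move=> n; apply: emeasurable_funM; last exact: measurable_density.
  exact/measurable_EFinP/measurable_funTS.
- by move=> n x [_ xD]; rewrite mule_ge0 ?lee_fin ?f0.
- move=> x [_ xD] m n mn; rewrite lee_wpmul2r ?lee_fin ?f0//.
  exact/lefP/nd_nnsfun_approx.
Qed.

End measure_with_density.

Section image_measure.
Local Open Scope ereal_scope.
Context d1 d2 (T1 : measurableType d1) (T2 : measurableType d2) (R : realType).
Variables (mu : {measure set T1 -> \bar R}) (phi : T1 -> T2).
Hypothesis mphi : measurable_fun [set: T1] phi.

Definition image_measure : {measure set T2 -> \bar R}.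
Proof.
by unshelve refine (pushforward mu phi : {measure set T2 -> \bar R}).
Defined.

Lemma image_measureE A : image_measure A = mu (phi @^-1` A).
Proof. by []. Qed.

Lemma ge0_integral_image E (g : T2 -> \bar R) : measurable E ->
    measurable_fun E g -> (forall y, E y -> 0 <= g y) ->
  \int[image_measure]_(y in E) g y = \int[mu]_(x in phi @^-1` E) g (phi x).
Proof.
move=> mE mg g0; rewrite (ge0_integral_pushforward mphi)// => y /[!inE]; exact: g0.
Qed.

End image_measure.

Lemma measurable_funV d (T : measurableType d) (R : realType) (D : set T) (f : T -> R) :
  measurable_fun D f -> measurable_fun D (fun x => (f x)^-1).
Proof.
move=> mf; rewrite (_ : (fun x => _) = fun x => f x * (f x ^+ 2) `^ (-1)).
  apply: measurable_funM => //; apply: (measurableT_comp (measurable_powR _)).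
  exact: measurable_funX.
apply/funext => x; rewrite powR_inv1 ?sqr_ge0//.
have [->|fx0] := eqVneq (f x) 0; first by rewrite mul0r invr0.
by rewrite expr2 invfM mulrA divff// mul1r.
Qed.

Section integrals_of_derivatives.
Context {R : realType}.
Local Notation leb := (@lebesgue_measure R).
Implicit Types (f F : R -> R) (a b l p x : R).

Lemma integral_is_derive f F a b : a < b ->
    (forall x, a <= x <= b -> is_derive x 1 F (f x)) ->
    (forall x, a <= x <= b -> {for x, continuous f}) ->
  (\int[leb]_(x in `[a, b]) (f x)%:E = (F b - F a)%:E)%E.
Proof.
move=> ab dF cf.
have cF x : a <= x <= b -> {for x, continuous F}.
  move=> /dF d; apply: differentiable_continuous; apply/derivable1_diffP.
  exact: ex_derive.
rewrite (@continuous_FTC2 _ f F)//.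
- apply: continuous_in_subspaceT => x; rewrite inE/= in_itv/=; exact: cf.
- split.
  + move=> x; rewrite in_itv/= => /andP[/ltW ax /ltW xb].
    by have := dF x; rewrite ax xb => /(_ isT) d; exact: ex_derive.
  + by apply: cvg_at_right_filter; apply: cF; rewrite lexx ltW.
  + by apply: cvg_at_left_filter; apply: cF; rewrite lexx ltW.
- move=> x; rewrite in_itv/= => /andP[/ltW ax /ltW xb].
  have := dF x; rewrite ax xb => /(_ isT) d.
  by rewrite derive1E; exact: derive_val.
Qed.

Let left_endpoint a b n : R := a + (b - a) / n.+2%:R.

Let left_endpoint_itv a b n : a < b -> a < left_endpoint a b n < b.
Proof.
move=> ab; rewrite ltrDl divr_gt0 ?subr_gt0//= -ltrBrDl.
by rewrite ltr_pdivrMr// ltr_pMr ?subr_gt0// ltr1n.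
Qed.

Let cvg_left_endpoint a b : left_endpoint a b n @[n --> \oo] --> a.
Proof.
rewrite -[X in _ --> X]addr0 -(mulr0 (b - a)); apply: cvgD; first exact: cvg_cst.
apply: cvgMl_tmp; have := @cvg_harmonic R; rewrite -cvg_shiftS; exact.
Qed.

Let itvocEbigcup a b : a < b ->
  `]a, b]%classic = \bigcup_n `[left_endpoint a b n, b]%classic.
Proof.
move=> ab; apply/seteqP; split => x /=.
  rewrite in_itv/= => /andP[ax xb]; have xa0 : 0 < x - a by rewrite subr_gt0.
  exists (Num.truncn ((b - a) / (x - a))) => //=; rewrite in_itv/= xb andbT.
  rewrite -lerBrDl ler_pdivrMr// mulrC -ler_pdivrMr//.
  by rewrite (le_trans (ltW (truncnS_gt _)))// ler_nat.
move=> [n _]; rewrite /= !in_itv/= => /andP[nx ->]; rewrite andbT.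
by apply: lt_le_trans nx; have /andP[] := left_endpoint_itv n ab.
Qed.

Lemma ge0_integral_is_derive_oc f F a b l : a < b ->
    (forall x, a < x <= b -> is_derive x 1 F (f x)) ->
    (forall x, a < x <= b -> {for x, continuous f}) ->
    (forall x, a < x <= b -> 0 <= f x) ->
    F x @[x --> a^'+] --> l ->
  (\int[leb]_(x in `]a, b]) (f x)%:E = (F b - l)%:E)%E.
Proof.
move=> ab dF cf f0 Fl.
have sub n x : left_endpoint a b n <= x <= b -> a < x <= b.
  move=> /andP[nx ->]; rewrite andbT; apply: lt_le_trans nx.
  by have /andP[] := left_endpoint_itv n ab.
have : (\int[leb]_(x in `[left_endpoint a b n, b]) (f x)%:E @[n --> \oo] -->
    \int[leb]_(x in `]a, b]) (f x)%:E)%E.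
  rewrite itvocEbigcup//; apply: ge0_nondecreasing_set_cvg_integral => //.
  - move=> m n mn; rewrite subsetEset; apply: subset_itvr.
    rewrite bnd_simp lerD2l ler_wpM2l ?subr_ge0 ?(ltW ab)//.
    by rewrite lef_pV2 ?posrE// ler_nat.
  - move=> n; apply/measurable_EFinP; apply: subspace_continuous_measurable_fun.
      exact: measurable_itv.
    apply: continuous_in_subspaceT => x; rewrite inE/= in_itv/= => /sub; exact: cf.
  - by move=> n x /=; rewrite in_itv/= lee_fin => /sub; exact: f0.
under eq_cvg => n.
  have /andP[_ nb] := left_endpoint_itv n ab.
  rewrite (integral_is_derive nb (fun x nxb => dF x (sub n x nxb))
    (fun x nxb => cf x (sub n x nxb))); over.
move=> cvg_int; apply: cvg_unique cvg_int _ => //.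
apply: cvg_EFin; first exact: nearW.
apply: cvgB; first exact: cvg_cst.
move/cvg_at_rightP: Fl; apply; split; last exact: cvg_left_endpoint.
by move=> n; have /andP[] := left_endpoint_itv n ab.
Qed.

Lemma integral_powR01 p : -1 < p ->
  (\int[leb]_(x in `]0%R, 1%R[) (x `^ p)%:E = ((p + 1)^-1)%:E)%E.
Proof.
move=> p1; have p0 : 0 < p + 1 by rewrite -ltrBlDr sub0r.
rewrite integral_itv_bndo_bndc; last first.
  by apply/measurable_EFinP; apply: measurable_funTS; exact: measurable_powR.
have dF x : 0 < x <= 1 ->
    is_derive x 1 (fun y : R => (p + 1)^-1 * y `^ (p + 1)) (x `^ p).
  move=> /andP[x0 _]; have -> : x `^ p = (p + 1)^-1 *: ((p + 1) * x `^ (p + 1 - 1)).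
    by rewrite addrK /GRing.scale/= mulKf// gt_eqF.
  by apply: is_deriveZ; exact: is_derive1_powR.
have cf x : 0 < x <= 1 -> {for x, continuous (fun y : R => y `^ p)}.
  move=> /andP[x0 _]; apply: differentiable_continuous; apply/derivable1_diffP.
  by apply: derivable_powR; rewrite in_itv/= x0.
have F0 : (p + 1)^-1 * x `^ (p + 1) @[x --> 0^'+] --> (0 : R).
  by rewrite -[X in _ --> X](mulr0 (p + 1)^-1); apply: cvgMl_tmp; exact: powR_cvg0.
have := ge0_integral_is_derive_oc ltr01 dF cf (fun x _ => powR_ge0 x p) F0.
by rewrite powR1 mulr1 subr0.
Qed.

Lemma integral_expRN a :
  (\int[leb]_(x in `]a, +oo[) (expR (- x))%:E = (expR (- a))%:E)%E.
Proof.
rewrite integral_itv_obnd_cbnd; last first.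
  by apply/measurable_EFinP; apply: measurableT_comp => //; exact: measurable_funN.
have dE x : is_derive x 1 (fun y : R => - expR (- y)) (expR (- x)).
  rewrite -[expR (- x)]opprK -[- expR _]mulrN1.
  exact: is_deriveN (is_derive1_comp (is_derive_expR _) (is_deriveNid _ _)).
have cE : continuous (fun y : R => expR (- y)).
  by move=> x; apply: continuous_comp; [exact: opp_continuous|exact: continuous_expR].
rewrite (@ge0_continuous_FTC2y _ _ (fun y : R => - expR (- y)) _ 0)//.
- by rewrite sub0e -EFinN opprK.
- by apply: continuous_subspaceT.
- by rewrite -[X in _ --> X]oppr0; apply: cvgN; exact: cvgr_expR.
- by apply: cvg_at_right_filter; apply: cvgN; exact: cE.
- by move=> x _; rewrite derive1E; exact: derive_val.
Qed.

End integrals_of_derivatives.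

Section changes_of_variable.
Context {R : realType}.
Local Notation leb := (@lebesgue_measure R).
Local Notation MR := (measurableTypeR R).

Let measurable_affine (a b : R) : measurable_fun setT (fun x : MR => a * x + b : MR).
Proof. by apply: measurable_funD => //; exact: mulrl_measurable. Qed.

Lemma lebesgue_measure_affine (a b : R) (a0 : 0 < a) A : measurable A ->
  leb A = (a%:E * image_measure leb (measurable_affine a b) A)%E.
Proof.
move=> mA; pose scaled := mscale (NngNum (ltW a0)) (image_measure leb (measurable_affine a b)).
rewrite (@lebesgue_measure_unique R scaled)// => _ [[u v] _ <-].
rewrite /= /mscale/= /pushforward.
rewrite (_ : _ @^-1` _ = `](u - b) / a, (v - b) / a]%classic); last first.
  by apply/seteqP; split => x /=;
    rewrite !in_itv/= ltr_pdivrMr// ler_pdivlMr// ltrBlDr lerBrDr (mulrC x).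
have lebE (x y : R) : leb `]x, y]%classic = (if (x < y)%R then (y - x)%:E else 0%E).
  by rewrite lebesgue_measure_itv/= lte_fin.
rewrite [LHS]lebE [X in (_ * X)%E]lebE ltr_pM2r ?invr_gt0// ltrD2r.
case: ifPn => uv; last by rewrite mule0.
by rewrite -EFinM; congr EFin; field; rewrite gt_eqF.
Qed.

Lemma ge0_integral_affine (a b : R) (f : R -> \bar R) : 0 < a ->
    measurable_fun setT f -> (forall x, (0 <= f x)%E) ->
  (\int[leb]_x f x = a%:E * \int[leb]_x f (a * x + b)%R)%E.
Proof.
move=> a0 mf f0; pose affine := image_measure leb (measurable_affine a b).
transitivity (\int[mscale (NngNum (ltW a0)) affine]_x f x)%E.
  by apply: eq_measure_integral => A mA _; exact: lebesgue_measure_affine.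
by rewrite ge0_integral_mscale// ge0_integral_image// preimage_setT.
Qed.

(* Slices the region between the graphs of [0] and of [exp(-h)], in the
   coordinate [z = - ln y], along the other axis. *)
Lemma integral_expRN_sublevel d (T : measurableType d)
    (mu : {sigma_finite_measure set T -> \bar R}) (D : set T) (h : T -> R) :
    measurable D -> measurable_fun setT h ->
  (\int[mu]_(x in D) (expR (- h x))%:E =
   \int[leb]_z ((expR (- z))%:E * mu (D `&` [set x | (h x < z)%R])))%E.
Proof.
move=> mD mh; pose W := [set w : T * MR | D w.1 /\ h w.1 < w.2].
have mW : measurable W.
  have mDT : measurable (fst @^-1` D : set (T * MR)).
    by rewrite -[X in measurable X]setTI; exact: measurable_fst.
  apply: measurableI => //.
  rewrite (_ : (fun w => _) = (fun w : T * MR => h w.1 < w.2) @^-1` [set true]); last first.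
    by apply/seteqP; split.
  rewrite -[X in measurable X]setTI; apply: measurable_fun_ltr => //.
  exact: (measurableT_comp mh measurable_fst).
pose k (w : T * MR) : \bar R := (\1_W w * expR (- w.2))%:E.
have mk : measurable_fun setT k.
  apply/measurable_EFinP; apply: measurable_funM; first exact: measurable_indic.
  by apply: measurableT_comp => //; apply: measurableT_comp => //; exact: measurable_snd.
have k0 w : (0 <= k w)%E by rewrite lee_fin mulr_ge0 ?expR_ge0.
transitivity (\int[mu]_x \int[leb]_z k (x, z))%E.
  rewrite integral_mkcond; apply: eq_integral => x _; rewrite patchE.
  case: ifPn => [/set_mem Dx|/negP Dx]; last first.
    rewrite integral0_eq// => z _; rewrite /k indicE memNset ?mul0r//= => -[/= Dx' _].
    by apply: Dx; rewrite inE.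
  rewrite -integral_expRN integral_mkcond; apply: eq_integral => z _.
  rewrite patchE /k indicE; case: ifPn => [/set_mem|/negP hz] /=.
    by rewrite in_itv/= andbT => hz; rewrite mem_set ?mul1r.
  rewrite memNset ?mul0r// => -[_ /= hz']; apply: hz.
  by rewrite inE/= in_itv/= hz'.
rewrite fubini_tonelli//; apply: eq_integral => z _.
have mDz : measurable (D `&` [set x | h x < z]).
  rewrite (_ : _ `&` _ = ysection W z); first exact: measurable_ysection.
  by apply/seteqP; split => x /=; rewrite /ysection/= inE.
have -> : mu (D `&` [set x | h x < z]) =
    (\int[mu]_x (\1_(D `&` [set x | (h x < z)%R]) x)%:E)%E.
  by rewrite integral_indic// setIT.
rewrite -ge0_integralZl_EFin ?expR_ge0//.
- by apply: eq_integral => x _; rewrite /k -EFinM mulrC !indicE.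
- by apply/measurable_EFinP; exact: measurable_indic.
Qed.

End changes_of_variable.

Section gamma_and_beta_integrals.
Context {R : realType}.
Local Notation leb := (@lebesgue_measure R).
Implicit Types a b k x z : R.

Definition gamma_integrand a x : R := x `^ (a - 1) * expR (- x) * \1_`]0%R, +oo[ x.

Definition beta_integrand a b x : R :=
  x `^ (a - 1) * (1 - x) `^ (b - 1) * \1_`]0%R, 1%R[ x.

Definition gamma_integral a : \bar R := (\int[leb]_x (gamma_integrand a x)%:E)%E.

Definition beta_integral a b : \bar R := (\int[leb]_x (beta_integrand a b x)%:E)%E.

Lemma gamma_integrand_ge0 a x : 0 <= gamma_integrand a x.
Proof. by rewrite !mulr_ge0 ?powR_ge0 ?expR_ge0. Qed.

Lemma beta_integrand_ge0 a b x : 0 <= beta_integrand a b x.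
Proof. by rewrite !mulr_ge0 ?powR_ge0. Qed.

Lemma gamma_integrand_gt0E a x : 0 < x -> gamma_integrand a x = x `^ (a - 1) * expR (- x).
Proof. by move=> x0; rewrite /gamma_integrand indicE mem_set ?mulr1//= in_itv/= x0. Qed.

Lemma gamma_integrand_le0E a x : x <= 0 -> gamma_integrand a x = 0.
Proof.
move=> x0; rewrite /gamma_integrand indicE memNset ?mulr0//=.
by rewrite in_itv/= andbT ltNge x0.
Qed.

Lemma beta_integrandE a b x : 0 < x < 1 ->
  beta_integrand a b x = x `^ (a - 1) * (1 - x) `^ (b - 1).
Proof. by move=> x01; rewrite /beta_integrand indicE mem_set ?mulr1. Qed.

Lemma beta_integrand_out a b x : ~~ (0 < x < 1) -> beta_integrand a b x = 0.
Proof.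
by move=> x01; rewrite /beta_integrand indicE memNset ?mulr0//=; exact/negP.
Qed.

Lemma measurable_gamma_integrand a : measurable_fun setT (gamma_integrand a).
Proof.
apply: measurable_funM; last exact: measurable_indic.
apply: measurable_funM; first exact: measurable_powR.
by apply: measurableT_comp => //; exact: measurableT_comp.
Qed.

Lemma measurable_beta_integrand a b : measurable_fun setT (beta_integrand a b).
Proof.
apply: measurable_funM; last exact: measurable_indic.
apply: measurable_funM; first exact: measurable_powR.
by apply: (measurableT_comp (measurable_powR _)); exact: measurable_funB.
Qed.

Let measurable_EFin_gamma_integrand a :
  measurable_fun setT (fun x => (gamma_integrand a x)%:E).
Proof. by apply/measurable_EFinP; exact: measurable_gamma_integrand. Qed.

Let EFin_gamma_integrand_ge0 a x : (0 <= (gamma_integrand a x)%:E)%E.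
Proof. by rewrite lee_fin gamma_integrand_ge0. Qed.

Lemma gamma_integral_ge0 a : (0 <= gamma_integral a)%E.
Proof. by apply: integral_ge0 => x _; exact: EFin_gamma_integrand_ge0. Qed.

Lemma beta_integral_ge0 a b : (0 <= beta_integral a b)%E.
Proof. by apply: integral_ge0 => x _; rewrite lee_fin beta_integrand_ge0. Qed.

Lemma gamma_integral_itv a : gamma_integral a =
  (\int[leb]_(x in `]0%R, +oo[) (x `^ (a - 1) * expR (- x))%:E)%E.
Proof.
rewrite [RHS]integral_mkcond; apply: eq_integral => x _.
by rewrite patchE /gamma_integrand indicE; case: ifPn; rewrite ?mulr1 ?mulr0.
Qed.

Lemma beta_integral_itv a b : beta_integral a b =
  (\int[leb]_(x in `]0%R, 1%R[) (x `^ (a - 1) * (1 - x) `^ (b - 1))%:E)%E.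
Proof.
rewrite [RHS]integral_mkcond; apply: eq_integral => x _.
by rewrite patchE /beta_integrand indicE; case: ifPn; rewrite ?mulr1 ?mulr0.
Qed.

Lemma gamma_integrand_scale a b x z : 0 < z ->
  z * (gamma_integrand a (z * x) * gamma_integrand b (z - z * x)) =
  gamma_integrand (a + b) z * beta_integrand a b x.
Proof.
move=> z0; have [x0|x0] := leP x 0.
  rewrite beta_integrand_out ?mulr0; last by rewrite ltNge x0.
  by rewrite gamma_integrand_le0E ?mul0r ?mulr0// pmulr_rle0.
have [x1|x1] := leP 1 x.
  rewrite beta_integrand_out ?mulr0; last by rewrite (ltNge x) x1 andbF.
  by rewrite (@gamma_integrand_le0E b) ?mulr0// subr_le0 ler_peMr// ltW.
have x1' : 0 < 1 - x by rewrite subr_gt0.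
have -> : z - z * x = z * (1 - x) by ring.
rewrite !gamma_integrand_gt0E ?mulr_gt0// beta_integrandE ?x0//.
rewrite !powRM ?(ltW z0) ?(ltW x0) ?(ltW x1')//.
have -> : a + b - 1 = 1 + ((a - 1) + (b - 1)) by ring.
rewrite (@powRD _ z 1) ?(gt_eqF z0) ?implybT// (@powRD _ z (a - 1)) ?(gt_eqF z0) ?implybT//.
rewrite powRr1 ?(ltW z0)//.
have -> : expR (- z) = expR (- (z * x)) * expR (- (z * (1 - x))).
  by rewrite -expRD; congr expR; ring.
by ring.
Qed.

Lemma gamma_integrand_convolution a b z :
  (\int[leb]_x (gamma_integrand a x * gamma_integrand b (z - x))%:E =
   (gamma_integrand (a + b) z)%:E * beta_integral a b)%E.
Proof.
have [z0|z0] := leP z 0.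
  rewrite gamma_integrand_le0E// mul0e integral0_eq// => x _.
  have [x0|x0] := leP x 0; first by rewrite gamma_integrand_le0E ?mul0r.
  by rewrite (@gamma_integrand_le0E b) ?mulr0// subr_le0 (le_trans z0)// ltW.
have conv0 x : (0 <= (gamma_integrand a x * gamma_integrand b (z - x))%:E)%E.
  by rewrite lee_fin mulr_ge0// gamma_integrand_ge0.
have mconv : measurable_fun setT
    (fun x => (gamma_integrand a x * gamma_integrand b (z - x))%:E).
  apply/measurable_EFinP; apply: measurable_funM; first exact: measurable_gamma_integrand.
  by apply: (measurableT_comp (measurable_gamma_integrand _)); exact: measurable_funB.
rewrite (ge0_integral_affine 0 z0 mconv conv0).
rewrite -ge0_integralZl_EFin ?(ltW z0)//; last first.
  apply: (measurableT_comp mconv); apply: measurable_funD => //; exact: mulrl_measurable.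
rewrite -ge0_integralZl_EFin ?gamma_integrand_ge0//; last 2 first.
- by move=> x _; rewrite lee_fin beta_integrand_ge0.
- by apply/measurable_EFinP; exact: measurable_beta_integrand.
by apply: eq_integral => x _; rewrite -!EFinM addr0 gamma_integrand_scale.
Qed.

Lemma gamma_integral_shift a x :
  gamma_integral a = (\int[leb]_z (gamma_integrand a (z - x))%:E)%E.
Proof.
rewrite /gamma_integral (ge0_integral_affine (- x) ltr01)// mul1e.
by apply: eq_integral => z _; rewrite mul1r.
Qed.

Lemma gamma_integralM a b :
  (gamma_integral a * gamma_integral b = gamma_integral (a + b) * beta_integral a b)%E.
Proof.
rewrite {1}/gamma_integral -ge0_integralZr ?gamma_integral_ge0//; last first.
  exact: measurable_EFin_gamma_integrand.
transitivity (\int[leb]_x \int[leb]_z (gamma_integrand a x * gamma_integrand b (z - x))%:E)%E.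
  apply: eq_integral => x _; rewrite (gamma_integral_shift b x).
  rewrite -ge0_integralZl_EFin ?gamma_integrand_ge0//.
  apply/measurable_EFinP; apply: (measurableT_comp (measurable_gamma_integrand _)).
  exact: measurable_funB.
rewrite (@fubini_tonelli _ _ _ _ _ leb leb
    (fun w => (gamma_integrand a w.1 * gamma_integrand b (w.2 - w.1))%:E))/=; last 2 first.
- apply/measurable_EFinP; apply: measurable_funM.
    exact: (measurableT_comp (measurable_gamma_integrand _) measurable_fst).
  apply: (measurableT_comp (measurable_gamma_integrand _)).
  by apply: measurable_funB; [exact: measurable_snd|exact: measurable_fst].
- by move=> w; rewrite lee_fin mulr_ge0// gamma_integrand_ge0.
under eq_integral do rewrite gamma_integrand_convolution.
rewrite ge0_integralZr ?beta_integral_ge0//; exact: measurable_EFin_gamma_integrand.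
Qed.

Lemma beta_integralr1 a : 0 < a -> beta_integral a 1 = (a^-1)%:E.
Proof.
move=> a0; rewrite beta_integral_itv.
under eq_integral do rewrite subrr powRr0 mulr1.
by rewrite integral_powR01 ?subrK// ltrBrDr addNr.
Qed.

Lemma gamma_integral1 : gamma_integral 1 = 1%E.
Proof.
rewrite gamma_integral_itv; under eq_integral do rewrite subrr powRr0 mul1r.
by rewrite integral_expRN oppr0 expR0.
Qed.

Lemma gamma_integralD1 a : 0 < a -> gamma_integral (a + 1) = (a%:E * gamma_integral a)%E.
Proof.
move=> a0; have := gamma_integralM a 1; rewrite gamma_integral1 mule1 beta_integralr1// => ->.
by rewrite muleC -muleA -EFinM mulVf ?mule1// gt_eqF.
Qed.

Lemma gamma_integral_nat_lty n : (gamma_integral n.+1%:R < +oo)%E.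
Proof.
elim: n => [|n ih]; first by rewrite gamma_integral1 ltry.
by rewrite -natr1 gamma_integralD1// lte_mul_pinfty.
Qed.

Lemma gamma_integrand_le a b x : 0 <= a <= b ->
  gamma_integrand (a + 1) x <= gamma_integrand 1 x + gamma_integrand (b + 1) x.
Proof.
move=> /andP[a0 ab]; have [x0|x0] := leP x 0; first by rewrite !gamma_integrand_le0E// addr0.
rewrite !gamma_integrand_gt0E// -mulrDl ler_wpM2r ?expR_ge0// !addrK subrr powRr0.
have [x1|x1] := leP x 1.
  rewrite ler_wpDr ?powR_ge0//; apply: (@le_trans _ _ (1 `^ a)); last by rewrite powR1.
  by apply: ge0_ler_powR; rewrite ?nnegrE// ltW.
by rewrite ler_wpDl// ler_powR// ltW.
Qed.

Lemma gamma_integral_lty a : 0 < a -> (gamma_integral a < +oo)%E.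
Proof.
move=> a0; have : (gamma_integral (a + 1) < +oo)%E.
  have [n an] : exists n, a <= n%:R by exists (Num.truncn a).+1; rewrite ltW// truncnS_gt.
  apply: (@le_lt_trans _ _ (gamma_integral 1 + gamma_integral n.+1%:R)%E); last first.
    apply: lte_add_pinfty; last exact: gamma_integral_nat_lty.
    by rewrite gamma_integral1 ltry.
  rewrite -ge0_integralD//; [|exact: measurable_EFin_gamma_integrand..].
  apply: ge0_le_integral => //; [exact: measurable_EFin_gamma_integrand| |].
    by apply: emeasurable_funD; exact: measurable_EFin_gamma_integrand.
  move=> x _; rewrite -EFinD lee_fin -natr1.
  by apply: gamma_integrand_le; rewrite (ltW a0).
rewrite gamma_integralD1// !ltey; apply: contra => /eqP ->.
by rewrite gt0_muley ?lte_fin.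
Qed.

Lemma gamma_integralE a : 0 < a -> gamma_integral a = (Gamma a)%:E.
Proof.
move=> a0; rewrite /Gamma /Rintegral -gamma_integral_itv fineK//.
by rewrite ge0_fin_numE ?gamma_integral_ge0// gamma_integral_lty.
Qed.

Lemma integral_powR_expRN a k : 0 < a -> 0 < k ->
  (\int[leb]_(x in `]0%R, +oo[) (x `^ (a - 1) * expR (- (k * x)))%:E =
   (k `^ (- a) * Gamma a)%:E)%E.
Proof.
move=> a0 k0; rewrite EFinM -gamma_integralE// /gamma_integral.
rewrite (ge0_integral_affine 0 k0)// integral_mkcond muleA -EFinM.
have mscaled : measurable_fun setT (fun x => (gamma_integrand a (k * x + 0))%:E).
  apply: (measurableT_comp (measurable_EFin_gamma_integrand a)).
  by apply: measurable_funD => //; exact: mulrl_measurable.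
rewrite -ge0_integralZl_EFin ?mulr_ge0 ?powR_ge0 ?(ltW k0)//.
apply: eq_integral => x _; rewrite patchE -EFinM addr0.
case: ifPn => [/set_mem|/negP] /=.
  rewrite in_itv/= andbT => x0; rewrite gamma_integrand_gt0E ?mulr_gt0//; congr EFin.
  rewrite powRM ?(ltW k0) ?(ltW x0)//.
  have -> : k `^ (a - 1) = k `^ a / k by rewrite powRB ?powRr1 ?(ltW k0)// (gt_eqF k0) implybT.
  have : 0 < k `^ a by rewrite powR_gt0.
  by rewrite powRN => /lt0r_neq0 ka0; field; rewrite ka0 lt0r_neq0.
move=> x0; rewrite gamma_integrand_le0E ?mulr0//.
by rewrite leNgt pmulr_rgt0//; apply/negP => xp; apply: x0; rewrite inE/= in_itv/= xp.
Qed.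

Lemma Gamma_gt0 a : 0 < a -> 0 < Gamma a.
Proof.
move=> a0; rewrite -lte_fin -gamma_integralE//.
pose m : R := expR (- 2) / 2; have m0 : 0 < m by rewrite divr_gt0 ?expR_gt0.
apply: (@lt_le_trans _ _ (\int[leb]_(x in `[1%R, 2%R]) (cst m%:E) x)%E).
  rewrite integral_cst//= lebesgue_measure_itv/= lte_fin ltr1n/= -EFinD -EFinM lte_fin.
  by rewrite mulr_gt0 ?subr_gt0 ?ltr1n.
apply: (@le_trans _ _ (\int[leb]_(x in `[1%R, 2%R]) (gamma_integrand a x)%:E)%E).
  apply: ge0_le_integral => //.
  - by move=> x _; rewrite lee_fin ltW.
  - by apply: measurable_funTS; exact: measurable_EFin_gamma_integrand.
  - move=> x /=; rewrite in_itv/= => /andP[x1 x2].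
    have x0 : 0 < x by rewrite (lt_le_trans ltr01).
    rewrite lee_fin gamma_integrand_gt0E// /m mulrC.
    rewrite ler_pM ?invr_ge0 ?expR_ge0 ?ler_expR ?lerN2//.
    apply: (@le_trans _ _ (x `^ (-1))).
      by rewrite powR_inv1 ?(ltW x0)// lef_pV2 ?posrE.
    by apply: ler_powR => //; rewrite lerBrDr addNr ltW.
apply: ge0_subset_integral => //; exact: measurable_EFin_gamma_integrand.
Qed.

Lemma GammaD1 a : 0 < a -> Gamma (a + 1) = a * Gamma a.
Proof.
move=> a0; apply: EFin_inj.
by rewrite EFinM -!gamma_integralE ?addr_gt0//; exact: gamma_integralD1.
Qed.

Lemma Gamma1 : Gamma (1 : R) = 1.
Proof. by apply: EFin_inj; rewrite -gamma_integralE// gamma_integral1. Qed.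

Lemma Gamma2 : Gamma (2 : R) = 1.
Proof. by rewrite (_ : 2 = 1 + 1)// GammaD1// Gamma1 mulr1. Qed.

Lemma beta_integralE a b : 0 < a -> 0 < b ->
  beta_integral a b = (Gamma a * Gamma b / Gamma (a + b))%:E.
Proof.
move=> a0 b0; have ab0 : 0 < a + b by rewrite addr_gt0.
rewrite EFinM EFinM -!gamma_integralE// gamma_integralM gamma_integralE// muleAC -EFinM.
by rewrite divff ?mul1e// gt_eqF// Gamma_gt0.
Qed.

Lemma Gamma32 : Gamma (3 / 2 : R) = Num.sqrt pi / 2.
Proof.
apply: EFin_inj; rewrite -gamma_integralE// -integral0y_gauss.
rewrite -integral_itv_obnd_cbnd; last first.
  by apply/measurable_EFinP; apply: measurable_funTS; exact: measurable_gauss_fun.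
rewrite (@integral_expRN_sublevel _ _ _ leb _ (fun x => x ^+ 2))//.
apply: eq_integral => z _; have [z0|z0] := leP z 0.
  rewrite gamma_integrand_le0E// (_ : _ `&` _ = set0) ?measure0 ?mule0//.
  by apply/seteqP; split => x //= [_]; rewrite ltNge (le_trans z0)// sqr_ge0.
have sublevelE : `]0, +oo[%classic `&` [set x : R | x ^+ 2 < z] = `]0, Num.sqrt z[%classic.
  apply/seteqP; split => x /=; rewrite !in_itv/= andbT.
    by move=> [x0 xz]; rewrite x0 -[x]gtr0_norm// -sqrtr_sqr ltr_sqrt.
  move=> /andP[x0 xz]; split=> //.
  by rewrite -(sqr_sqrtr (ltW z0)) ltr_pXn2r// nnegrE ?sqrtr_ge0// ltW.
have lebE : leb `]0, Num.sqrt z[%classic = (Num.sqrt z)%:E.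
  by rewrite lebesgue_measure_itv/= lte_fin sqrtr_gt0 z0 oppr0 adde0.
rewrite sublevelE [X in (_ * X)%E]lebE -EFinM.
have -> : (3 / 2 : R) = 2^-1 + 1 by field.
by rewrite gamma_integrand_gt0E// addrK powR12_sqrt ?(ltW z0)// mulrC.
Qed.

Lemma Gamma12 : Gamma (1 / 2 : R) = Num.sqrt pi.
Proof.
have := Gamma32; rewrite (_ : 3 / 2 = 1 / 2 + 1); last by field.
by rewrite GammaD1//; lra.
Qed.

End gamma_and_beta_integrals.

Section mellin_transforms.
Context {R : realType}.
Local Notation leb := (@lebesgue_measure R).
Local Notation MR := (measurableTypeR R).
Implicit Types (mu nu : {measure set MR -> \bar R}) (f g : R -> R).

Definition mellin_transform f : Prop :=
  exists mu, mu `]-oo, 0%R[%classic = 0%E /\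
    forall s, 0 <= s -> mellin mu s = (f s)%:E.

Lemma mellin_nat mu n : mellin mu n%:R = (\int[mu]_(x in `[0%R, +oo[) (x ^+ n)%:E)%E.
Proof.
apply: eq_integral => x; rewrite inE/= in_itv/= andbT => x0.
by rewrite powR_mulrn.
Qed.

Lemma eq_mellin mu nu : (forall A, measurable A -> mu A = nu A) -> mellin mu =1 mellin nu.
Proof. by move=> mu_nu s; apply: eq_measure_integral => A mA _; exact: mu_nu. Qed.

Lemma mellin_transform_inj f g (K M : R) : 0 < M ->
    (forall n, f n%:R <= K * M ^+ n) -> (forall n, f n%:R = g n%:R) ->
    mellin_transform f -> mellin_transform g ->
  forall s, 0 <= s -> f s = g s.
Proof.
move=> M0 fK fg [mu [mu0 muE]] [nu [nu0 nuE]] s s0.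
have mu_f : stieltjes_represents mu (fun n => f n%:R).
  by split=> // n; rewrite -mellin_nat muE.
have nu_f : stieltjes_represents nu (fun n => f n%:R).
  by split=> // n; rewrite -mellin_nat nuE// fg.
apply: EFin_inj; rewrite -muE// -nuE//.
exact: eq_mellin (stieltjes_represents_inj M0 fK mu_f nu_f) s.
Qed.

Lemma geometric_growth (u : nat -> R) (M : R) :
  (forall n, u n.+1 <= M * u n) -> 0 <= M -> forall n, u n <= u 0%N * M ^+ n.
Proof.
move=> uM M0; elim=> [|n ih]; first by rewrite mulr1.
by rewrite (le_trans (uM n))// exprS mulrCA ler_wpM2l.
Qed.

Lemma eq_mellin_transform_rec f g (r : R -> R) (M : R) : 0 < M ->
    mellin_transform f -> mellin_transform g -> f 0 = g 0 ->
    (forall s, 0 <= s -> f (s + 1) = r s * f s) ->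
    (forall s, 0 <= s -> g (s + 1) = r s * g s) ->
    (forall s, 0 <= s -> 0 <= r s <= M) ->
  forall s, 0 <= s -> f s = g s.
Proof.
move=> M0 Mf Mg fg0 fS gS r0M.
have f0 s : 0 <= s -> 0 <= f s.
  move=> s0; have [mu [_ muE]] := Mf; rewrite -lee_fin -muE//.
  by apply: integral_ge0 => x _; rewrite lee_fin powR_ge0.
apply: (mellin_transform_inj M0 _ _ Mf Mg).
- apply: geometric_growth (ltW M0) => n; rewrite -natr1 fS//.
  by rewrite ler_wpM2r ?f0//; have /andP[] := r0M n%:R (ler0n _ _).
- by elim=> [//|n ih]; rewrite -natr1 fS// gS// ih.
Qed.

Lemma mellin_transform_image d (T : measurableType d) (mu : {measure set T -> \bar R})
    (D : set T) (phi w : T -> R) f :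
    measurable D -> measurable_fun setT phi -> measurable_fun D w ->
    (forall x, D x -> 0 <= phi x) -> (forall x, D x -> 0 <= w x) ->
    (forall s, 0 <= s -> (\int[mu]_(x in D) (phi x `^ s * w x)%:E = (f s)%:E)%E) ->
  mellin_transform f.
Proof.
move=> mD mphi mw phi0 w0 fE.
have mphiR : measurable_fun setT (phi : T -> MR) by [].
exists (image_measure (density_measure mu mD mw w0) mphiR); split.
  rewrite image_measureE density_measureE (_ : _ `&` D = set0) ?integral_set0//.
  apply/seteqP; split => x //= [+ Dx]; rewrite in_itv/=.
  by apply/negP; rewrite -leNgt phi0.
move=> s s0; rewrite -fE// /mellin ge0_integral_image//; last 2 first.
- by apply/measurable_EFinP; apply: measurable_funTS; exact: measurable_powR.
- by move=> y _; rewrite lee_fin powR_ge0.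
rewrite ge0_integral_density//.
- rewrite (_ : _ `&` D = D)//; apply: setIidr => x Dx /=.
  by rewrite in_itv/= andbT phi0.
- by rewrite -[X in measurable X]setTI; exact: mphi.
- apply/measurable_EFinP; apply: measurable_funTS.
  exact: (measurableT_comp (measurable_powR _)).
- by move=> y _; rewrite lee_fin powR_ge0.
Qed.

End mellin_transforms.

Lemma powR22M (R : realType) (s : R) : 2 `^ (2 * s) = 4 `^ s.
Proof. by rewrite powRrM powR_mulrn// -natrX. Qed.

Section legendre_duplication.
Context {R : realType}.
Implicit Types s : R.

Let beta_diag s : R := Gamma (s + 1) * Gamma (s + 1) / Gamma (s + 1 + (s + 1)).
Let beta_half s : R :=
  2^-1 * 4 `^ (- s) * (Gamma (s + 1) * Gamma (1 / 2) / Gamma (s + 1 + 1 / 2)).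

Let ratio s : R := (s + 1) / (4 * s + 6).

Let beta_diagD1 s : 0 <= s -> beta_diag (s + 1) = ratio s * beta_diag s.
Proof.
move=> s0; rewrite /beta_diag /ratio (@GammaD1 _ (s + 1)); last by lra.
have -> : s + 1 + 1 + (s + 1 + 1) = (s + 1 + (s + 1)) + 1 + 1 by ring.
rewrite (@GammaD1 _ (s + 1 + (s + 1) + 1)); last by lra.
rewrite (@GammaD1 _ (s + 1 + (s + 1))); last by lra.
have : 0 < Gamma (s + 1 + (s + 1)) by apply: Gamma_gt0; lra.
move: (Gamma (s + 1)) (Gamma _) => x y /lt0r_neq0 y0.
by field; rewrite y0 !lt0r_neq0//; lra.
Qed.

Let beta_halfD1 s : 0 <= s -> beta_half (s + 1) = ratio s * beta_half s.
Proof.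
move=> s0; rewrite /beta_half /ratio (@GammaD1 _ (s + 1)); last by lra.
have -> : s + 1 + 1 + 1 / 2 = (s + 1 + 1 / 2) + 1 by ring.
rewrite (@GammaD1 _ (s + 1 + 1 / 2)); last by lra.
rewrite opprD powRD; last by rewrite pnatr_eq0 implybT.
rewrite powR_inv1//.
have : 0 < Gamma (s + 1 + 1 / 2) by apply: Gamma_gt0; lra.
move: (Gamma (s + 1)) (Gamma (1 / 2)) (Gamma _) (4 `^ (- s)) => x y z w /lt0r_neq0 z0.
by field; rewrite z0 !lt0r_neq0//; lra.
Qed.

Let mellin_beta_diag : mellin_transform beta_diag.
Proof.
apply: (@mellin_transform_image _ _ _ (@lebesgue_measure R) `]0%R, 1%R[%classic
  (fun u => u * (1 - u)) (cst 1)) => //.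
- by apply: measurable_funM => //; exact: measurable_funB.
- by move=> x /=; rewrite in_itv/= => /andP[x0 x1]; rewrite mulr_ge0 ?subr_ge0 ?ltW.
- move=> s s0; rewrite -beta_integralE ?ltr_wpDl// beta_integral_itv.
  apply: eq_integral => x; rewrite inE/= in_itv/= => /andP[x0 x1].
  by rewrite mulr1 addrK powRM// ?subr_ge0 ltW.
Qed.

Let mellin_beta_half : mellin_transform beta_half.
Proof.
have mpowB (p : R) : measurable_fun setT (fun u : R => (1 - u) `^ p).
  by apply: (measurableT_comp (measurable_powR _)); exact: measurable_funB.
apply: (@mellin_transform_image _ _ _ (@lebesgue_measure R) `]0%R, 1%R[%classic
  (fun u => u / 4) (fun u => 2^-1 * (1 - u) `^ (1 / 2 - 1))) => //.
- exact: mulrr_measurable.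
- by apply: measurable_funTS; apply: measurable_funM => //; exact: mpowB.
- by move=> x /=; rewrite in_itv/= => /andP[/ltW x0 _]; rewrite divr_ge0.
- by move=> x _; rewrite mulr_ge0// powR_ge0.
- move=> s s0; rewrite /beta_half [RHS]EFinM -beta_integralE ?ltr_wpDl//.
  rewrite beta_integral_itv -ge0_integralZl_EFin//.
  + apply: eq_integral => x; rewrite inE/= in_itv/= => /andP[x0 x1].
    rewrite -EFinM; congr EFin.
    by rewrite addrK powRM ?(ltW x0)// -[4^-1]powR_inv1// -powRrM mulN1r; ring.
  + by move=> x _; rewrite lee_fin mulr_ge0// powR_ge0.
  + apply/measurable_EFinP; apply: measurable_funTS; apply: measurable_funM => //.
    exact: mpowB.
Qed.

Let beta_diag_half s : 0 <= s -> beta_diag s = beta_half s.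
Proof.
apply: (eq_mellin_transform_rec ltr01 mellin_beta_diag mellin_beta_half _
  beta_diagD1 beta_halfD1); last first.
  by move=> t t0; rewrite /ratio divr_ge0 ?ler_pdivrMr; lra.
rewrite /beta_diag /beta_half oppr0 powRr0 !add0r Gamma1 (_ : 1 + 1 = 2)// Gamma2.
rewrite (_ : 1 + 1 / 2 = 3 / 2); last by field.
have : 0 < Num.sqrt pi :> R by rewrite sqrtr_gt0 pi_gt0.
by rewrite Gamma12 Gamma32 => /lt0r_neq0 pi0; field.
Qed.

Lemma Gamma_duplication s : 0 <= s ->
  2 `^ (2 * s) * Gamma (s + 1 / 2) * Gamma (s + 1) = Num.sqrt pi * Gamma (2 * s + 1).
Proof.
move=> s0; have := beta_diag_half s0; rewrite /beta_diag /beta_half powRN powR22M Gamma12.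
have -> : s + 1 + (s + 1) = (2 * s + 1) + 1 by ring.
have -> : s + 1 + 1 / 2 = (s + 1 / 2) + 1 by ring.
rewrite (@GammaD1 _ (2 * s + 1)); last by lra.
rewrite (@GammaD1 _ (s + 1 / 2)); last by lra.
have [x0 y0 z0] : [/\ 0 < Gamma (s + 1), 0 < Gamma (2 * s + 1) & 0 < Gamma (s + 1 / 2)].
  by split; apply: Gamma_gt0; lra.
have w0 : 0 < 4 `^ s :> R by rewrite powR_gt0.
move: (Gamma (s + 1)) (Gamma (2 * s + 1)) (Gamma (s + 1 / 2)) (4 `^ s) (Num.sqrt pi) x0 y0 z0 w0.
move=> x y z w q x0 y0 z0 w0 xyzE.
have -> : w * z * x = (x * x / ((2 * s + 1) * y)) * ((2 * s + 1) * y * w * z / x).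
  by field; rewrite !lt0r_neq0//; lra.
by rewrite xyzE; field; rewrite !lt0r_neq0//; lra.
Qed.

End legendre_duplication.

Section logarithm_series.
Context {R : realType}.
Implicit Types t x : R.

Let log_poly n : {poly R} := \sum_(k < n) (k.+1%:R^-1 *: 'X^(k.+1)).

Let horner_log_poly n t : (log_poly n).[t] = series (fun k => t ^+ k.+1 / k.+1%:R) n.
Proof.
rewrite /series/= big_mkord horner_sum; apply: eq_bigr => k _.
by rewrite hornerZ hornerXn mulrC.
Qed.

Let horner_deriv_log_poly n t : (log_poly n)^`().[t] = \sum_(k < n) t ^+ k.
Proof.
rewrite (linear_sum (@deriv R)) horner_sum; apply: eq_bigr => k _ /=.
by rewrite derivZ derivXn hornerZ hornerMn hornerXn -[X in _ * X]mulr_natl mulKf.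
Qed.

Let log_remainder n t : R := - ln (1 - t) - (log_poly n).[t].

Let is_derive_log_remainder n t : t < 1 ->
  is_derive t 1 (log_remainder n) (t ^+ n / (1 - t)).
Proof.
move=> t1; have t1' : 0 < 1 - t by rewrite subr_gt0.
have d1B : is_derive t 1 (fun u : R => 1 - u) (- 1).
  by rewrite -[- 1]add0r; exact: is_deriveB.
have dln1B := @is_derive1_comp R (@ln R) (fun u => 1 - u) _ _ _ (is_derive1_ln t1') d1B.
have -> : t ^+ n / (1 - t) = - ((1 - t)^-1 * -1) - (log_poly n)^`().[t].
  rewrite horner_deriv_log_poly mulrN1 opprK; apply: (mulfI (lt0r_neq0 t1')).
  rewrite mulrCA divff ?lt0r_neq0// mulrBr divff ?lt0r_neq0//.
  by have := subrX1 t n; lra.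
exact: is_deriveB (is_deriveN dln1B) (is_derive_poly (log_poly n) t).
Qed.

Let log_remainder_itv n x : 0 <= x < 1 ->
  0 <= log_remainder n x <= (1 - x)^-1 * x ^+ n.
Proof.
move=> /andP[x0 x1]; have x1' : 0 < 1 - x by rewrite subr_gt0.
have lt1 t : t \in `]0, x[ -> t < 1.
  by rewrite in_itv/= => /andP[_ /lt_trans]; exact.
have cF : {within `[0, x], continuous (log_remainder n)}.
  apply: continuous_in_subspaceT => t; rewrite inE/= in_itv/= => /andP[_ tx].
  apply: differentiable_continuous; apply/derivable1_diffP.
  by have d := is_derive_log_remainder n (le_lt_trans tx x1); exact: ex_derive.
have [t] := MVT_segment x0 (fun t t0x => is_derive_log_remainder n (lt1 t t0x)) cF.
have -> : log_remainder n 0 = 0.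
  rewrite /log_remainder subr0 ln1 oppr0 add0r horner_log_poly /series/=.
  by rewrite big1 ?oppr0// => k _; rewrite expr0n mul0r.
rewrite in_itv/= !subr0 => /andP[t0 tx] ->; rewrite mulrAC [_ / _]mulrC.
have t1' : 0 < 1 - t by rewrite subr_gt0 (le_lt_trans tx).
rewrite !mulr_ge0 ?invr_ge0 ?exprn_ge0 ?(ltW t1')//=.
rewrite ler_pM ?invr_ge0 ?mulr_ge0 ?exprn_ge0 ?(ltW t1')//.
  by rewrite lef_pV2 ?posrE// lerD2l lerN2.
by rewrite -[leRHS]mulr1 ler_pM ?exprn_ge0 ?(ltW x1)// lerXn2r ?nnegrE.
Qed.

Lemma cvg_series_Nln1B x : 0 <= x < 1 ->
  series (fun n => x ^+ n.+1 / n.+1%:R) @ \oo --> - ln (1 - x).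
Proof.
move=> x01; have /andP[x0 x1] := x01.
apply: (@squeeze_cvgr _ _ _ _ (fun n => - ln (1 - x) - (1 - x)^-1 * x ^+ n)
    (fun=> - ln (1 - x))).
- near=> n; rewrite -horner_log_poly.
  by have := log_remainder_itv n x01; rewrite /log_remainder; lra.
- rewrite -[X in _ --> X]subr0 -[X in _ --> _ - X](mulr0 (1 - x)^-1).
  apply: cvgB; first exact: cvg_cst.
  by apply: cvgMl_tmp; apply: cvg_expr; rewrite ger0_norm.
- exact: cvg_cst.
Unshelve. all: by end_near.
Qed.

End logarithm_series.

(* [mu] may charge the negative reals: what represents a Stieltjes moment sequence
   below is its image under [x |-> b exp(-x)]. *)
Definition laplace_transform (R : realType) (f : R -> R) : Prop :=
  exists mu : {measure set (measurableTypeR R) -> \bar R},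
    forall s, 0 <= s -> (\int[mu]_x (expR (- (s * x)))%:E = (f s)%:E)%E.

Section laplace_transforms.
Context {R : realType}.
Implicit Types f g : R -> R.
Local Notation leb := (@lebesgue_measure R).
Local Notation MR := (measurableTypeR R).

Lemma measurable_expRNM (s : R) : measurable_fun setT (fun x : MR => (expR (- (s * x)))%:E).
Proof.
apply/measurable_EFinP; apply: measurableT_comp => //.
by apply: measurableT_comp => //; exact: mulrl_measurable.
Qed.

Lemma laplace_transform_ge0 f (s : R) : laplace_transform f -> 0 <= s -> 0 <= f s.
Proof.
move=> [mu muE] s0; rewrite -lee_fin -muE//.
by apply: integral_ge0 => x _; rewrite lee_fin expR_ge0.
Qed.

Lemma laplace_transform_finite f : laplace_transform f ->
  exists mu : {finite_measure set MR -> \bar R},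
    forall s, 0 <= s -> (\int[mu]_x (expR (- (s * x)))%:E = (f s)%:E)%E.
Proof.
move=> [mu muE]; have mu_lty : (mu setT < +oo)%E.
  have := muE 0 (lexx _); under eq_integral do rewrite mul0r oppr0 expR0.
  by rewrite integral_cst// mul1e => ->; rewrite ltry.
exists (mfrestr measurableT mu_lty) => s s0; rewrite -muE//.
by apply: eq_measure_integral => A mA _; rewrite /= /mfrestr /mrestr setIT.
Qed.

Lemma eq_laplace_transform f g : (forall s, 0 <= s -> f s = g s) ->
  laplace_transform f -> laplace_transform g.
Proof. by move=> fg [mu muE]; exists mu => s s0; rewrite muE// fg. Qed.

Lemma laplace_transform1 : laplace_transform (fun=> 1 : R).
Proof.
exists (\d_(0%R : MR)) => s s0; rewrite integral_dirac//=.
  by rewrite diracT mul1e mulr0 oppr0 expR0.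
exact: measurable_expRNM.
Qed.

Lemma laplace_transformZ (k : R) f : 0 <= k -> laplace_transform f ->
  laplace_transform (fun s => k * f s).
Proof.
move=> k0 [mu muE]; exists (mscale (NngNum k0) mu) => s s0.
by rewrite ge0_integral_mscale//= ?muE//; exact: measurable_expRNM.
Qed.

Lemma laplace_transformM f g : laplace_transform f -> laplace_transform g ->
  laplace_transform (fun s => f s * g s).
Proof.
move=> lf lg; have [mu muE] := laplace_transform_finite lf.
have [nu nuE] := laplace_transform_finite lg.
have madd : measurable_fun setT (fun z : MR * MR => z.1 + z.2 : MR).
  by apply: measurable_funD; [exact: measurable_fst|exact: measurable_snd].
exists (image_measure (mu \x nu)%E madd) => s s0.
rewrite ge0_integral_image//; last exact: measurable_expRNM.
rewrite preimage_setT.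
rewrite (fubini_tonelli1 (fun z : MR * MR => (expR (- (s * (z.1 + z.2))))%:E)); last 2 first.
- exact: (measurableT_comp (measurable_expRNM s) madd).
- by move=> z; rewrite lee_fin expR_ge0.
rewrite /fubini_F/=.
under eq_integral => x _.
  under eq_integral do rewrite mulrDr opprD expRD EFinM.
  rewrite ge0_integralZl_EFin ?expR_ge0//; last exact: measurable_expRNM.
  rewrite nuE// muleC; over.
rewrite ge0_integralZl_EFin ?laplace_transform_ge0//; last exact: measurable_expRNM.
by rewrite muE// muleC.
Qed.

Lemma laplace_transformX f n : laplace_transform f -> laplace_transform (fun s => f s ^+ n).
Proof.
move=> lf; elim: n => [|n ih]; first exact: laplace_transform1.
by apply: eq_laplace_transform (laplace_transformM lf ih) => s _; rewrite exprS.
Qed.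

Lemma laplace_transform_series (F : nat -> R -> R) f :
    (forall n, laplace_transform (F n)) ->
    (forall s, 0 <= s -> series (F ^~ s) @ \oo --> f s) ->
  laplace_transform f.
Proof.
move=> lF Ff; pose m n := sval (cid (lF n)); exists (mseries m 0) => s s0.
rewrite ge0_integral_measure_series//; last exact: measurable_expRNM.
apply/cvg_lim => //; under eq_cvg => n.
  rewrite (eq_bigr (fun k => (F k s)%:E)); last by move=> k _; exact: (svalP (cid (lF k))).
  rewrite sumEFin; over.
by apply: cvg_EFin; [exact: nearW|exact: Ff].
Qed.

Lemma laplace_transformD f g : laplace_transform f -> laplace_transform g ->
  laplace_transform (fun s => f s + g s).
Proof.
move=> [mu muE] [nu nuE]; exists (measure_add mu nu) => s s0.
rewrite ge0_integral_measure_add//; last exact: measurable_expRNM.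
by rewrite muE// nuE.
Qed.

Lemma laplace_transform_expR f :
  laplace_transform f -> laplace_transform (fun s => expR (f s)).
Proof.
move=> lf; apply: (@laplace_transform_series (fun n s => n`!%:R^-1 * f s ^+ n)).
- by move=> n; apply: laplace_transformZ; [rewrite invr_ge0|exact: laplace_transformX].
- move=> s s0; have := @is_cvg_series_exp_coeff R (f s).
  rewrite /expR; apply: cvg_trans; apply: near_eq_cvg; near=> n.
  by rewrite /series/=; apply: eq_bigr => k _; rewrite /exp_coeff/= mulrC.
Unshelve. all: by end_near.
Qed.

Lemma laplace_transform_Nln1B f : laplace_transform f ->
    (forall s, 0 <= s -> f s < 1) ->
  laplace_transform (fun s => - ln (1 - f s)).
Proof.
move=> lf f1; apply: (@laplace_transform_series (fun n s => n.+1%:R^-1 * f s ^+ n.+1)).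
- by move=> n; apply: laplace_transformZ; [rewrite invr_ge0|exact: laplace_transformX].
- move=> s s0; have -> : (fun n => n.+1%:R^-1 * f s ^+ n.+1) =
      (fun n => f s ^+ n.+1 / n.+1%:R) by apply/funext => n; rewrite mulrC.
  by apply: cvg_series_Nln1B; rewrite laplace_transform_ge0//= f1.
Qed.

Lemma laplace_transform_powRN (a p : R) : 0 < a -> 0 < p ->
  laplace_transform (fun s => (s + a) `^ (- p)).
Proof.
move=> a0 p0; have G0 := Gamma_gt0 p0.
have gamma_law : laplace_transform (fun s => (s + a) `^ (- p) * Gamma p).
  pose w (x : MR) : R := x `^ (p - 1) * expR (- (a * x)).
  pose D : set MR := `]0%R, +oo[%classic; have mD : measurable D by exact: measurable_itv.
  have w0 x : D x -> 0 <= w x by rewrite mulr_ge0 ?powR_ge0 ?expR_ge0.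
  have mw : measurable_fun D w.
    apply: measurable_funTS; apply: measurable_funM; first exact: measurable_powR.
    by apply/measurable_EFinP; exact: measurable_expRNM.
  exists (density_measure leb mD mw w0) => s s0.
  rewrite ge0_integral_density//; last exact: measurable_expRNM.
  rewrite setTI -integral_powR_expRN ?ltr_wpDl//; apply: eq_integral => x _.
  by rewrite -EFinM /w mulrCA -expRD mulrDl opprD.
apply: eq_laplace_transform (laplace_transformZ (_ : 0 <= (Gamma p)^-1) gamma_law) => [s s0|].
  by rewrite mulrC mulfK ?lt0r_neq0.
by rewrite invr_ge0 ltW.
Qed.

End laplace_transforms.

Lemma is_cvg_series_telescope (R : realType) (u v : R^nat) :
    (forall k, 0 <= u k) -> (forall k, 0 <= v k) ->
    (forall k, u k <= v k - v k.+1) ->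
  cvgn (series u).
Proof.
move=> u0 v0 uv; apply: nondecreasing_is_cvgn.
  by apply/nondecreasing_seqP => n; rewrite seriesSr lerDl.
exists (v 0%N) => _ [n _ <-]; apply: (@le_trans _ _ (v 0%N - v n)); last first.
  by rewrite gerBl.
elim: n => [|n ih]; first by rewrite /series/= big_geq// subrr.
by rewrite seriesSr (le_trans (lerD ih (uv n)))// addrA subrK.
Qed.

Section infinite_product.
Context {R : realType}.
Implicit Types a c h s x : R.

Definition ln_diff2 h x : R := 2 * ln x - ln (x - h) - ln (x + h).

Lemma ln_diff2E h x : 0 < h < x -> ln_diff2 h x = - ln (1 - (h / x) ^+ 2).
Proof.
move=> /andP[h0 hx]; have x0 : 0 < x by rewrite (lt_trans h0).
have [xBh xDh] : 0 < x - h /\ 0 < x + h by split; lra.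
have -> : 1 - (h / x) ^+ 2 = (x - h) * (x + h) / (x * x) by field; rewrite lt0r_neq0.
rewrite ln_div ?posrE ?mulr_gt0// !lnM ?posrE//; rewrite /ln_diff2; lra.
Qed.

Lemma sqr_ratio_itv01 h x : 0 < h < x -> 0 <= (h / x) ^+ 2 < 1.
Proof.
move=> /andP[h0 hx]; have x0 : 0 < x by rewrite (lt_trans h0).
by rewrite sqr_ge0 expr_lt1 ?divr_ge0 ?ltW//= ltr_pdivrMr ?mul1r.
Qed.

Lemma ln_diff2_ge0 h x : 0 < h < x -> 0 <= ln_diff2 h x.
Proof.
move=> hx; rewrite ln_diff2E// oppr_ge0 ln_le0//.
by have := sqr_ratio_itv01 hx; lra.
Qed.

Lemma laplace_transform_ln_diff2 h a : 0 < h < a ->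
  laplace_transform (fun s => ln_diff2 h (s + a)).
Proof.
move=> /andP[h0 ha]; have a0 : 0 < a by rewrite (lt_trans h0).
have hsa s : 0 <= s -> 0 < h < s + a by move=> s0; rewrite h0 ltr_wpDl.
have ratioE s : 0 <= s -> h ^+ 2 * (s + a) `^ (- 2) = (h / (s + a)) ^+ 2.
  by move=> s0; rewrite powRN powR_mulrn ?expr_div_n// addr_ge0// ltW.
have ratio_lt1 s : 0 <= s -> h ^+ 2 * (s + a) `^ (- 2) < 1.
  by move=> s0; rewrite ratioE//; have /andP[] := sqr_ratio_itv01 (hsa s s0).
have := laplace_transform_Nln1B (laplace_transformZ (sqr_ge0 h)
  (laplace_transform_powRN a0 (ltr0Sn R 1))) ratio_lt1.
by apply: eq_laplace_transform => s s0; rewrite ratioE// ln_diff2E// hsa.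
Qed.

Definition ln_gap s : R := ln (s + 1) - ln (s + 1 / 2).

Lemma ln_gap_ge0 s : 0 <= s -> 0 <= ln_gap s.
Proof. by move=> s0; rewrite subr_ge0 ler_ln ?posrE; lra. Qed.

Lemma ln_gapB s : ln_gap s - ln_gap (s + 1 / 2) = ln_diff2 (1 / 2) (s + 1).
Proof.
rewrite /ln_gap /ln_diff2 (_ : s + 1 / 2 + 1 / 2 = s + 1); last by field.
rewrite (_ : s + 1 / 2 + 1 = s + 1 + 1 / 2); last by ring.
by rewrite (_ : s + 1 - 1 / 2 = s + 1 / 2); [ring|field].
Qed.

(* For a function [psi] with [psi (s + 1) / psi s = (s + 1/2) / (s + 2)], this is
   [ln (phi s / phi (s + 1))] where [phi s = (s + 1)^(3/2) psi s]. *)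
Definition ln_defect s : R := 3 / 2 * ln (s + 1) - ln (s + 1 / 2) - 2^-1 * ln (s + 2).

Lemma ln_defect_gap s : ln_defect s =
  ln_gap s - 2^-1 * (ln_gap (s + 1 / 2) + ln_gap (s + 1 / 2 + 1 / 2)).
Proof.
rewrite /ln_defect /ln_gap (_ : s + 1 / 2 + 1 / 2 = s + 1); last by field.
rewrite (_ : s + 1 + 1 / 2 = s + 1 / 2 + 1); last by ring.
by rewrite (_ : s + 1 + 1 = s + 2); [field|ring].
Qed.

Lemma ln_defectE s :
  ln_defect s = ln_diff2 (1 / 2) (s + 1) + 2^-1 * ln_diff2 (1 / 2) (s + 3 / 2).
Proof.
rewrite (_ : s + 3 / 2 = s + 1 / 2 + 1); last by field.
by rewrite -!ln_gapB ln_defect_gap; field.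
Qed.

Lemma laplace_transform_ln_defect a : 0 <= a ->
  laplace_transform (fun s => ln_defect (s + a)).
Proof.
move=> a0; have [a1 a32] : 0 < (1 / 2 : R) < a + 1 /\ 0 < (1 / 2 : R) < a + 3 / 2.
  by split; lra.
apply: eq_laplace_transform (laplace_transformD (laplace_transform_ln_diff2 a1)
  (laplace_transformZ (_ : 0 <= 2^-1) (laplace_transform_ln_diff2 a32))) => //.
by move=> s _; rewrite ln_defectE !addrA.
Qed.

Lemma ln_defect_ge0 s : 0 <= s -> 0 <= ln_defect s.
Proof.
move=> s0; rewrite ln_defectE addr_ge0 ?mulr_ge0 ?ln_diff2_ge0//; lra.
Qed.

Lemma ln_defect_le_gap s : 0 <= s -> ln_defect s <= ln_gap s - ln_gap (s + 1).
Proof.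
move=> s0; rewrite ln_defect_gap.
have : 0 <= ln_gap (s + 1 / 2) - ln_gap (s + 1 / 2 + 1 / 2).
  by rewrite ln_gapB ln_diff2_ge0//; lra.
by rewrite (_ : s + 1 / 2 + 1 / 2 = s + 1); [lra|field].
Qed.

Lemma is_cvg_ln_defect_series s : 0 <= s ->
  cvgn (series (fun k => ln_defect (s + k%:R))).
Proof.
move=> s0; apply: (is_cvg_series_telescope (v := fun k => ln_gap (s + k%:R))) => k.
- by rewrite ln_defect_ge0 ?addr_ge0.
- by rewrite ln_gap_ge0 ?addr_ge0.
- by rewrite -natr1 addrA ln_defect_le_gap ?addr_ge0.
Qed.

Definition ln_defect_sum s : R := limn (series (fun k => ln_defect (s + k%:R))).

Lemma ln_defect_sumD1 s : 0 <= s ->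
  ln_defect_sum s = ln_defect s + ln_defect_sum (s + 1).
Proof.
move=> s0; have s1 : 0 <= s + 1 by rewrite addr_ge0.
apply/cvg_lim => //; rewrite -cvg_shiftS.
under eq_cvg => n.
  rewrite /series/= big_nat_recl// addr0.
  under eq_bigr do rewrite -nat1r addrA.
  over.
by apply: cvgD; [exact: cvg_cst|exact: is_cvg_ln_defect_series].
Qed.

Lemma laplace_transform_ln_defect_sum : laplace_transform ln_defect_sum.
Proof.
apply: (@laplace_transform_series _ (fun k s => ln_defect (s + k%:R))).
- by move=> k; exact: laplace_transform_ln_defect.
- by move=> s s0; exact: is_cvg_ln_defect_series.
Qed.

(* For [s >= 0] this is [Gamma (s + 1/2) / (sqrt pi * Gamma (s + 2))], by
   [catalan_mellinE]. *)
Definition gamma_quotient s : R :=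
  (s + 1) `^ (- (3 / 2)) * expR (ln_defect_sum s - ln_defect_sum 0).

Lemma gamma_quotient_ge0 s : 0 <= gamma_quotient s.
Proof. by rewrite mulr_ge0 ?powR_ge0 ?expR_ge0. Qed.

Lemma gamma_quotient0 : gamma_quotient 0 = 1.
Proof. by rewrite /gamma_quotient add0r powR1 subrr expR0 mulr1. Qed.

Lemma gamma_quotientD1 s : 0 <= s ->
  gamma_quotient (s + 1) = (s + 1 / 2) / (s + 2) * gamma_quotient s.
Proof.
move=> s0; have [s1 s2 s12] : [/\ 0 < s + 1, 0 < s + 2 & 0 < s + 1 / 2] by split; lra.
have powRE x (p : R) : 0 < x -> x `^ p = expR (p * ln x).
  by move=> x0; rewrite /powR gt_eqF.
rewrite /gamma_quotient (ln_defect_sumD1 s0) (_ : s + 1 + 1 = s + 2); last by ring.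
rewrite !powRE// -[X in X / _ * _]lnK ?posrE// -[X in _ / X * _]lnK ?posrE//.
by rewrite -expRN -!expRD; congr expR; rewrite /ln_defect; field.
Qed.

Lemma laplace_transform_gamma_quotient_powR c : 0 < c ->
  laplace_transform (fun s => gamma_quotient s `^ c).
Proof.
move=> c0; have p0 : 0 < 3 / 2 * c by rewrite mulr_gt0.
apply: eq_laplace_transform (laplace_transformM (laplace_transform_powRN ltr01 p0)
  (laplace_transformZ (expR_ge0 (- (c * ln_defect_sum 0))) (laplace_transform_expR
    (laplace_transformZ (ltW c0) laplace_transform_ln_defect_sum)))).
move=> s s0; rewrite /gamma_quotient powRM ?powR_ge0 ?expR_ge0// -powRrM mulNr.
by rewrite -expRM -expRD; congr (_ * expR _); ring.
Qed.

End infinite_product.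

Section catalan_numbers.
Context {R : realType}.
Local Notation leb := (@lebesgue_measure R).
Local Notation MR := (measurableTypeR R).
Implicit Types (c s u x : R) (n : nat).

Lemma catalan0 : catalan R 0 = 1.
Proof. by rewrite /catalan bin0 divr1. Qed.

Lemma catalanS n :
  catalan R n.+1 = 4 * (n%:R + 1 / 2) / (n%:R + 2) * catalan R n.
Proof.
have fact_neq0 k : k`!%:R != 0 :> R by rewrite pnatr_eq0 -lt0n fact_gt0.
have n0 : 0 <= n%:R :> R by [].
rewrite !catalan_fact doubleS !factS !natrM.
have -> : n.*2.+2%:R = 2 * (n%:R + 1) :> R by rewrite -muln2 -natr1 -natr1 natrM; ring.
have -> : n.*2.+1%:R = 2 * n%:R + 1 :> R by rewrite -muln2 -natr1 natrM; ring.
have -> : n.+2%:R = n%:R + 2 :> R by rewrite -natr1 -natr1; ring.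
have -> : n.+1%:R = n%:R + 1 :> R by rewrite -natr1.
move: (n%:R) (n.*2`!%:R) (n`!%:R) (fact_neq0 n) n0 => x y z z0 x0.
by field; rewrite z0 !lt0r_neq0//; lra.
Qed.

Lemma catalan_gt0 n : 0 < catalan R n.
Proof. by rewrite catalan_fact divr_gt0 ?mulr_gt0 ?ltr0n ?fact_gt0. Qed.

Lemma catalan_le n : catalan R n <= 4 ^+ n.
Proof.
have ratio_le k : catalan R k.+1 <= 4 * catalan R k.
  rewrite catalanS ler_wpM2r ?(ltW (catalan_gt0 k))//.
  by have k0 : 0 <= k%:R :> R by []; rewrite ler_pdivrMr; lra.
by have := geometric_growth ratio_le (ler0n R 4) n; rewrite catalan0 mul1r.
Qed.

Lemma catalan_powR_le c n : 0 < c -> catalan R n `^ c <= 1 * (4 `^ c) ^+ n.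
Proof.
move=> c0; rewrite mul1r -powR_mulrn ?powR_ge0// powRAC powR_mulrn//.
by apply: ge0_ler_powR; rewrite ?nnegrE ?exprn_ge0 ?catalan_le// ltW// catalan_gt0.
Qed.

Lemma catalan_powR_measure_unique c (mu nu : {measure set MR -> \bar R}) : 0 < c ->
    stieltjes_represents mu (fun n => catalan R n `^ c) ->
    stieltjes_represents nu (fun n => catalan R n `^ c) ->
  forall A, measurable A -> mu A = nu A.
Proof.
move=> c0; apply: (@stieltjes_represents_inj _ _ _ _ 1 (4 `^ c)).
  by rewrite powR_gt0.
by move=> n; exact: catalan_powR_le.
Qed.

Definition catalan_mellin s : R :=
  2 `^ (2 * s) / Num.sqrt pi * (Gamma (s + 1 / 2) / Gamma (s + 2)).

Lemma catalan_mellin0 : catalan_mellin 0 = 1.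
Proof.
rewrite /catalan_mellin mulr0 powRr0 !add0r Gamma12 Gamma2.
by field; rewrite lt0r_neq0// sqrtr_gt0 pi_gt0.
Qed.

Lemma catalan_mellinD1 s : 0 <= s ->
  catalan_mellin (s + 1) = 4 * (s + 1 / 2) / (s + 2) * catalan_mellin s.
Proof.
move=> s0; rewrite /catalan_mellin !powR22M.
have -> : s + 1 + 1 / 2 = (s + 1 / 2) + 1 by ring.
have -> : s + 1 + 2 = (s + 2) + 1 by ring.
rewrite (@GammaD1 _ (s + 1 / 2)); last by lra.
rewrite (@GammaD1 _ (s + 2)); last by lra.
rewrite powRD ?pnatr_eq0 ?implybT// powRr1//.
have : 0 < Gamma (s + 2) by apply: Gamma_gt0; lra.
have : 0 < Num.sqrt pi :> R by rewrite sqrtr_gt0 pi_gt0.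
move: (4 `^ s) (Gamma (s + 1 / 2)) (Gamma (s + 2)) (Num.sqrt pi) => w x y z z0 y0.
by field; rewrite !lt0r_neq0//; lra.
Qed.

Lemma catalan_mellin_nat n : catalan_mellin n%:R = catalan R n.
Proof.
elim: n => [|n ih]; first by rewrite catalan_mellin0 catalan0.
by rewrite -natr1 catalan_mellinD1// ih catalanS.
Qed.

Lemma catalan_mellin_duplication s : 0 <= s ->
  catalan_mellin s = (s + 1)^-1 * (Gamma (2 * s + 1) / Gamma (s + 1) ^+ 2).
Proof.
move=> s0; have := Gamma_duplication s0; rewrite /catalan_mellin.
have -> : s + 2 = (s + 1) + 1 by ring.
rewrite (@GammaD1 _ (s + 1)); last by lra.
have : 0 < Num.sqrt pi :> R by rewrite sqrtr_gt0 pi_gt0.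
have : 0 < Gamma (s + 1) by apply: Gamma_gt0; rewrite ltr_wpDl.
move: (2 `^ _) (Gamma (s + 1 / 2)) (Gamma (s + 1)) (Gamma (2 * s + 1)) (Num.sqrt pi).
move=> w x y z q y0 q0 wxyE.
have -> : z = w * x * y / q by rewrite wxyE mulrAC divff ?mul1r// lt0r_neq0.
by field; rewrite !lt0r_neq0//; lra.
Qed.

Lemma catalan_density_ge0 x : 0 <= catalan_density x.
Proof. by rewrite mulr_ge0 ?sqrtr_ge0// invr_ge0 mulr_ge0// pi_ge0. Qed.

Lemma measurable_catalan_density (D : set MR) :
  measurable_fun D (@catalan_density R : MR -> R).
Proof.
apply: measurable_funTS; apply: measurable_funM => //.
apply: (@measurableT_comp _ _ _ _ _ _ (@Num.sqrt R)).
  by apply: continuous_measurable_fun; exact: sqrt_continuous.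
by apply: measurable_funM; [exact: measurable_funB|exact: measurable_funV].
Qed.

Lemma catalan_density_beta s u : 0 < u < 1 ->
  (4 * u) `^ s * catalan_density (4 * u) =
  4 `^ s / (2 * pi) * beta_integrand (s + 1 / 2) (3 / 2) u.
Proof.
move=> u01; have /andP[u0 u1] := u01; have u1' : 0 < 1 - u by rewrite subr_gt0.
rewrite beta_integrandE// /catalan_density.
have -> : (4 - 4 * u) / (4 * u) = (1 - u) / u by field; rewrite lt0r_neq0.
have -> : Num.sqrt ((1 - u) / u) = (1 - u) `^ 2^-1 * u `^ (- 2^-1).
  rewrite -powR12_sqrt ?divr_ge0 ?(ltW u0) ?(ltW u1')//.
  rewrite powRM ?invr_ge0 ?(ltW u0) ?(ltW u1')// -[- 2^-1]mulN1r powRrM.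
  by rewrite powR_inv1 ?(ltW u0).
rewrite powRM ?(ltW u0)//.
have -> : s + 1 / 2 - 1 = s - 2^-1 by field.
have -> : 3 / 2 - 1 = 2^-1 :> R by field.
rewrite (@powRD _ u s); last by rewrite (gt_eqF u0) implybT.
by move: (4 `^ s) (u `^ s) (2 * pi)^-1 (_ `^ 2^-1) (_ `^ _) => *; ring.
Qed.

Lemma integral_catalan_density s : 0 <= s ->
  (\int[leb]_(x in `]0%R, 4%R]) (x `^ s * catalan_density x)%:E = (catalan_mellin s)%:E)%E.
Proof.
move=> s0; rewrite integral_mkcond; set f := (_ \_ _).
have mf : measurable_fun setT f.
  apply/(measurable_restrictT _ (measurable_itv _)); apply/measurable_EFinP.
  apply: measurable_funM; last exact: measurable_catalan_density.
  by apply: measurable_funTS; exact: measurable_powR.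
have f0 x : (0 <= f x)%E.
  apply: erestrict_ge0 => y _.
  by rewrite lee_fin mulr_ge0 ?powR_ge0 ?catalan_density_ge0.
rewrite (@ge0_integral_affine _ 4 0)//; have pi0 : 0 < pi :> R := pi_gt0 R.
transitivity (4%:E * \int[leb]_u ((4 `^ s / (2 * pi))%:E *
    (beta_integrand (s + 1 / 2) (3 / 2) u)%:E))%E.
  congr (_ * _)%E; apply: eq_integral => u _; rewrite addr0 /f patchE.
  have [u01|u01] := boolP (0 < u < 1).
    rewrite mem_set; last by rewrite /= in_itv/=; lra.
    by rewrite catalan_density_beta// EFinM.
  rewrite beta_integrand_out// mule0; case: ifPn => // /set_mem/=; rewrite in_itv/= => u4.
  have -> : u = 1 by move: u01; rewrite negb_and -!leNgt; lra.
  by rewrite /catalan_density mulr1 subrr mul0r sqrtr0 !mulr0.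
rewrite ge0_integralZl_EFin//; first last.
- by rewrite divr_ge0 ?powR_ge0// mulr_ge0// ltW.
- by apply/measurable_EFinP; exact: measurable_beta_integrand.
- by move=> u _; rewrite lee_fin beta_integrand_ge0.
rewrite -/(beta_integral _ _) beta_integralE ?Gamma32; [|lra..].
rewrite -!EFinM; congr EFin; rewrite /catalan_mellin powR22M.
have -> : s + 1 / 2 + 3 / 2 = s + 2 by field.
have : 0 < Gamma (s + 2) by apply: Gamma_gt0; rewrite ltr_wpDl.
have : 0 < Num.sqrt pi :> R by rewrite sqrtr_gt0.
rewrite -[in LHS](sqr_sqrtr (ltW pi0)) [Num.sqrt (_ ^+ 2)]sqrtr_sqr ger0_norm ?sqrtr_ge0//.
move: (Num.sqrt pi) (4 `^ s) (Gamma (s + 1 / 2)) (Gamma (s + 2)) => q w x y q0 y0.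
by field; rewrite !lt0r_neq0.
Qed.

Let support : set MR := `]0%R, 4%R]%classic.

Let measurable_support : measurable support.
Proof. exact: measurable_itv. Qed.

Definition catalan_measure : {measure set MR -> \bar R} :=
  density_measure leb measurable_support (@measurable_catalan_density support)
    (fun x _ => catalan_density_ge0 x).

Lemma catalan_measureE A : catalan_measure A =
  (\int[leb]_(x in A `&` `]0%R, 4%R]) (catalan_density x)%:E)%E.
Proof. by []. Qed.

Lemma catalan_measure_neg0 : catalan_measure `]-oo, 0%R[%classic = 0%E.
Proof.
rewrite catalan_measureE (_ : _ `&` _ = set0) ?integral_set0//.
by apply/seteqP; split => x //= []; rewrite !in_itv/= => x0 /andP[/ltW]; rewrite leNgt x0.
Qed.

Lemma mellin_catalan_measure s : 0 <= s -> mellin catalan_measure s = (catalan_mellin s)%:E.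
Proof.
move=> s0; rewrite -integral_catalan_density// /mellin ge0_integral_density//.
- rewrite (_ : _ `&` _ = support)//; apply: setIidr => x /=.
  by rewrite /support !in_itv/= andbT => /andP[/ltW].
- by apply/measurable_EFinP; apply: measurable_funTS; exact: measurable_powR.
- by move=> x _; rewrite lee_fin powR_ge0.
Qed.

Lemma mellin_transform_catalan_mellin : mellin_transform catalan_mellin.
Proof.
exists catalan_measure; split; first exact: catalan_measure_neg0.
exact: mellin_catalan_measure.
Qed.

Lemma mellin_transform_gamma_quotient_powR c : 0 < c ->
  mellin_transform (fun s => (4 `^ s * gamma_quotient s) `^ c).
Proof.
move=> c0; have [mu muE] := laplace_transform_gamma_quotient_powR c0.
apply: (@mellin_transform_image _ _ _ mu setT (fun x => 4 `^ c * expR (- x)) (cst 1)) => //.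
- by apply: measurable_funM => //; apply: measurableT_comp => //; exact: measurableT_comp.
- move=> s s0; rewrite powRM ?powR_ge0 ?gamma_quotient_ge0// EFinM -muE//.
  rewrite -ge0_integralZl_EFin ?powR_ge0//; last exact: measurable_expRNM.
  apply: eq_integral => x _; rewrite -EFinM mulr1 powRM ?powR_ge0 ?expR_ge0//.
  by rewrite powRAC -expRM mulNr (mulrC x).
Qed.

Lemma catalan_mellinE s : 0 <= s -> catalan_mellin s = 4 `^ s * gamma_quotient s.
Proof.
apply: (@eq_mellin_transform_rec R _ (fun s => 4 `^ s * gamma_quotient s)
  (fun s => 4 * (s + 1 / 2) / (s + 2)) 4) => //.
- exact: mellin_transform_catalan_mellin.
- have [mu [mu0 muE]] := mellin_transform_gamma_quotient_powR ltr01.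
  exists mu; split=> // t t0.
  by rewrite muE// powRr1// mulr_ge0 ?powR_ge0 ?gamma_quotient_ge0.
- by rewrite catalan_mellin0 powRr0 gamma_quotient0 mulr1.
- exact: catalan_mellinD1.
- move=> t t0; rewrite gamma_quotientD1// powRD ?pnatr_eq0 ?implybT// powRr1//; ring.
- by move=> t t0; rewrite divr_ge0 ?ler_pdivrMr; lra.
Qed.

Lemma mellin_transform_catalan_mellin_powR c : 0 < c ->
  mellin_transform (fun s => catalan_mellin s `^ c).
Proof.
move=> /mellin_transform_gamma_quotient_powR[mu [mu0 muE]].
by exists mu; split=> // s s0; rewrite muE// catalan_mellinE.
Qed.

Lemma catalan_powR_measure_exists c : 0 < c -> exists mu : {measure set MR -> \bar R},
  stieltjes_represents mu (fun n => catalan R n `^ c) /\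
  forall s, 0 <= s -> mellin mu s = (catalan_mellin s `^ c)%:E.
Proof.
move=> /mellin_transform_catalan_mellin_powR[mu [mu0 muE]].
by exists mu; do 2!split=> //; move=> n; rewrite -mellin_nat muE// catalan_mellin_nat.
Qed.

Lemma stieltjes_represents_catalan : stieltjes_represents catalan_measure (catalan R).
Proof.
split=> [|n]; first exact: catalan_measure_neg0.
by rewrite -mellin_nat mellin_catalan_measure// catalan_mellin_nat.
Qed.

Lemma catalan_powR1 : (fun n => catalan R n `^ 1) = catalan R.
Proof. by apply/funext => n; rewrite powRr1// ltW// catalan_gt0. Qed.

End catalan_numbers.

Theorem theorem1 (R : realType) :
  [/\ stieltjes_infinitely_divisible (catalan R),
      (forall c : R, 0 < c ->
         stieltjes_determinate (fun n => catalan R n `^ c)),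
      (forall mu : {measure set (measurableTypeR R) -> \bar R},
         stieltjes_represents mu (fun n => catalan R n `^ 1) ->
         forall A : set (measurableTypeR R), measurable A ->
           mu A = (\int[@lebesgue_measure R]_(x in A `&` `]0%R, 4%R])
                     (catalan_density x)%:E)%E) &
      (forall (c : R) (mu : {measure set (measurableTypeR R) -> \bar R}),
         0 < c ->
         stieltjes_represents mu (fun n => catalan R n `^ c) ->
         forall s : R, 0 <= s ->
           mellin mu s =
             ((2 `^ (2 * s) / Num.sqrt pi * (Gamma (s + 1 / 2) / Gamma (s + 2)))
                `^ c)%:E /\
           mellin mu s =
             (((s + 1)^-1 * (Gamma (2 * s + 1) / Gamma (s + 1) ^+ 2))
                `^ c)%:E)].
Proof.
have moment (c : R) : 0 < c -> stieltjes_moment (fun n => catalan R n `^ c).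
  by move=> /catalan_powR_measure_exists[mu [mu_rep _]]; exists mu.
split.
- split; last exact: moment.
  by exists catalan_measure; exact: stieltjes_represents_catalan.
- move=> c c0; split; first exact: moment.
  by move=> mu nu; exact: catalan_powR_measure_unique.
- move=> mu mu_rep A mA; rewrite -catalan_measureE.
  apply: (catalan_powR_measure_unique ltr01 mu_rep) mA.
  by rewrite catalan_powR1; exact: stieltjes_represents_catalan.
- move=> c mu c0 mu_rep s s0; have [nu [nu_rep nuE]] := catalan_powR_measure_exists c0.
  rewrite (eq_mellin (catalan_powR_measure_unique c0 mu_rep nu_rep)) nuE//.
  by rewrite -catalan_mellin_duplication.
Qed.
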